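(* Let $G$ be a countable group that is relatively hyperbolic with respect to a finite family of subgroups $\mathbb{P}=\{P_1,\dots,P_n\}$. (1) If $H\le G$ is relatively quasiconvex in $(G,\mathbb{P})$, then $H$ is relatively hyperbolic with respect to the induced peripheral structure $\mathbb{O}$ on $H$. (2) If $H_1,H_2\le G$ are relatively quasiconvex in $(G,\mathbb{P})$, then $H_1\cap H_2$ is also relatively quasiconvex in $(G,\mathbb{P})$.
   Context: **Relative hyperbolicity.** Let $G$ be a countable group and $\mathbb{P}=\{P_1,\dots,P_n\}$ a finite collection of subgroups. $(G,\mathbb{P})$ is relatively hyperbolic if $G$ acts on a connected graph $K$ (edges of length one) such that: $K$ is $\delta$-hyperbolic for some $\delta$; $K$ is fine, i.e. for each $n$ each edge lies in only finitely many circuits (simple closed edge paths) of length $n$; edge stabilizers are finite; there are finitely many orbits of edges; and $\mathbb{P}$ is a set of representatives of the conjugacy classes of infinite vertex stabilizers. (The paper uses several equivalent definitions; this is one of them.) **Relative quasiconvexity.** A symmetric set $\mathcal{S}\subseteq G$ is a relative generating set for $(G,\mathbb{P})$ if $\mathcal{S}\cup P_1\cup\dots\cup P_n$ generates $G$; a finite one exists when $(G,\mathbb{P})$ is relatively hyperbolic. Let $\mathcal{P}$ be the union of the $P_i$ (nontrivial elements). A metric on $G$ is proper if all its balls are finite. A subgroup $H\le G$ is relatively quasiconvex in $(G,\mathbb{P})$ if for some (equivalently, any) finite relative generating set $\mathcal{S}$ and some (equivalently, any) proper left invariant metric $d$ on $G$ there is a constant $\kappa$ such that for each geodesic $\bar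 c$ in $\mathrm{Cayley}(G,\mathcal{S}\cup\mathcal{P})$ (edges of length one) connecting two points of $H$, every vertex of $\bar c$ lies within $d$-distance $\kappa$ of $H$. **Induced peripheral structure.** For $H$ relatively quasiconvex in $(G,\mathbb{P})$, let $\bar{\mathbb{O}}=\{H\cap gPg^{-1} : g\in G,\ P\in\mathbb{P},\ H\cap gPg^{-1}\text{ infinite}\}$. An induced peripheral structure $\mathbb{O}$ on $H$ is a set of representatives of the $H$-conjugacy classes of elements of $\bar{\mathbb{O}}$. *)

(* Defs.v *)
From HB Require Import structures.
From mathcomp Require Import all_boot all_order all_algebra.
From mathcomp Require Import boolp classical_sets functions cardinality reals.

Set Implicit Arguments.
Unset Strict Implicit.
Unset Printing Implicit Defensive.

Import Order.TTheory GRing.Theory Num.Theory.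
Local Open Scope classical_set_scope.
Local Open Scope group_scope.

Record subgroup (G : groupType) := Subgroup {
  subgroup_set :> set G;
  subgroup_closed : group_closed (fun x : G => x \in subgroup_set) }.

Lemma subgroup_eqP (G : groupType) (A B : subgroup G) :
  (A : set G) = B -> A = B.
Proof.
by case: A B => [A hA] [B hB] /= eqAB; subst B; congr Subgroup; apply: Prop_irrelevance.
Qed.

Lemma group_closed_set (G : groupType) (A : set G) :
    A 1 -> (forall x y, A x -> A y -> A (x / y)) ->
  group_closed (fun x : G => x \in A).
Proof.
move=> A1 AF; split=> [|x y]; first exact/mem_set.
by move=> /set_mem Ax /set_mem Ay; apply/mem_set/AF.
Qed.

Section SubgroupGroup.
Variables (G : groupType) (H : subgroup G).

Definition subgroup_type : Type := {x : G | x \in (H : set G)}.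

HB.instance Definition _ := SubChoice.on subgroup_type.
HB.instance Definition _ :=
  SubChoice_isSubGroup.Build G (fun x : G => x \in (H : set G)) subgroup_type
    (subgroup_closed H).

End SubgroupGroup.

Definition subgroup_group (G : groupType) (H : subgroup G) : groupType :=
  subgroup_type H.

Coercion subgroup_group : subgroup >-> Group.type.

Lemma subgroupI_closed (G : groupType) (A B : subgroup G) :
  group_closed (fun x : G => x \in (A : set G) `&` B).
Proof.
have [A1 AF] := subgroup_closed A; have [B1 BF] := subgroup_closed B.
apply: group_closed_set; first by split; apply/set_mem.
by move=> x y [/mem_set Ax /mem_set Bx] [/mem_set Ay /mem_set By];
   split; apply/set_mem; [apply: AF|apply: BF].
Qed.

Definition subgroupI (G : groupType) (A B : subgroup G) : subgroup G :=
  Subgroup (subgroupI_closed A B).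

(* [x ^ g] is [g^-1 * (x * g)], so this says [B = g A g^-1] for some [g]. *)
Definition conjugate_subgroups (G : groupType) (A B : subgroup G) : Prop :=
  exists g : G, (B : set G) = [set x | (A : set G) (x ^ g)].

Definition conjugacy_representatives (G : groupType)
    (F O : set (subgroup G)) : Prop :=
  O `<=` F /\
  forall A, F A -> exists! B, O B /\ conjugate_subgroups B A.

(* Loops and multiple edges are allowed: [edge] is the type of oriented edges
   and [erev] reverses the orientation, so that a geometric edge is a pair
   [{e, erev e}]. *)
Record graph := Graph {
  vertex : choiceType;
  edge : choiceType;
  src : edge -> vertex;
  erev : edge -> edge;
  erevK : involutive erev;
  erev_neq : forall e, erev e != e }.

Section GraphTheory.
Variable K : graph.
Implicit Types (x y z v w : vertex K) (e : edge K) (p q r c : seq (edge K)).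

Definition tgt e : vertex K := src (erev e).

Fixpoint edge_path x p y : Prop :=
  if p is e :: p' then src e = x /\ edge_path (tgt e) p' y else x = y.

Definition path_vertices x p : seq (vertex K) := x :: map tgt p.

Definition geodesic x p y : Prop :=
  edge_path x p y /\ forall q, edge_path x q y -> (size p <= size q)%N.

Definition within_distance (n : nat) x y : Prop :=
  exists2 p, edge_path x p y & (size p <= n)%N.

Definition connected_graph : Prop :=
  (exists x : vertex K, True) /\ forall x y, exists p, edge_path x p y.

(* Slimness is tested on vertices only; this changes just the value of [delta]
   compared with the geometric realization. *)
Definition hyperbolic_graph (delta : nat) : Prop :=
  forall x y z p q r,
    geodesic x p y -> geodesic y q z -> geodesic x r z ->
  forall v, v \in path_vertices x p ->
  exists2 w, w \in path_vertices y q ++ path_vertices x r &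
             within_distance delta v w.

(* Circuits are based and oriented: a geometric circuit of length [n] gives at
   most [2 n] of them. The last clause only matters for length 2: it excludes [e] followed
   by [erev e]. *)
Definition circuit c : Prop :=
  [/\ c <> [::], exists x, edge_path x c x, uniq (map (@src K) c) &
      forall e, e \in c -> erev e \notin c].

Definition fine_graph : Prop :=
  forall (n : nat) e, finite_set [set c | [/\ circuit c, size c = n & e \in c]].

End GraphTheory.

(* An element may reverse an edge, whence the second case in
   [edge_stabilizer]. *)
Record graph_action (G : groupType) (K : graph) := GraphAction {
  vact : G -> vertex K -> vertex K;
  eact : G -> edge K -> edge K;
  vact1 : forall x, vact 1 x = x;
  vactM : forall g h x, vact (g * h) x = vact g (vact h x);
  eact1 : forall e, eact 1 e = e;
  eactM : forall g h e, eact (g * h) e = eact g (eact h e);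
  act_src : forall g e, src (eact g e) = vact g (src e);
  act_erev : forall g e, erev (eact g e) = eact g (erev e) }.

Section GraphActionTheory.
Variables (G : groupType) (K : graph) (a : graph_action G K).

Lemma vertex_stabilizer_closed (v : vertex K) :
  group_closed (fun g : G => g \in [set g | vact a g v = v]).
Proof.
apply: group_closed_set => [|g h /= gv hv]; first exact: vact1.
by rewrite -[in LHS]hv -vactM mulgVK.
Qed.

Definition vertex_stabilizer (v : vertex K) : subgroup G :=
  Subgroup (vertex_stabilizer_closed v).

Definition edge_stabilizer (e : edge K) : set G :=
  [set g | eact a g e = e \/ eact a g e = erev e].

Definition edge_orbit (e : edge K) : set (edge K) :=
  [set eact a g e | g in [set: G]].

Definition infinite_vertex_stabilizers : set (subgroup G) :=
  [set A | infinite_set (A : set G) /\ exists v, A = vertex_stabilizer v].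

End GraphActionTheory.

Definition relatively_hyperbolic (G : groupType) (PP : set (subgroup G)) : Prop :=
  finite_set PP /\
  exists (K : graph) (a : graph_action G K),
    [/\ connected_graph K,
        exists delta, hyperbolic_graph K delta &
        fine_graph K] /\
    [/\ forall e : edge K, finite_set (edge_stabilizer a e),
        finite_set (range (edge_orbit a)) &
        conjugacy_representatives (infinite_vertex_stabilizers a) PP].

(* Vertices are the elements of [G]; an edge joins [x] to [x s] for each
   [s <> 1] in [A] or in [A^-1]; the omitted loops lie on no geodesic. *)
Section Cayley.
Variables (G : groupType) (A : set G).

Definition cayley_adjacent : set (G * G) :=
  [set e | e.1 <> e.2 /\ (A (e.1^-1 * e.2) \/ A (e.2^-1 * e.1))].

Lemma cayley_adjacent_swap (e : G * G) :
  e \in cayley_adjacent -> (e.2, e.1) \in cayley_adjacent.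
Proof.
by move=> /set_mem[e12 eA]; apply/mem_set; split=> /=; [apply/nesym|case: eA; tauto].
Qed.

Definition cayley_rev (e : cayley_adjacent) : cayley_adjacent :=
  exist (fun f : G * G => f \in cayley_adjacent) _ (cayley_adjacent_swap (valP e)).

Lemma cayley_revK : involutive cayley_rev.
Proof. by move=> e; apply: val_inj => /=; case: (val e). Qed.

Lemma cayley_rev_neq (e : cayley_adjacent) : cayley_rev e != e.
Proof.
apply/eqP => /(congr1 (fun u : cayley_adjacent => (val u).2)) /= e12.
by have /set_mem[] := valP e.
Qed.

Definition cayley_graph : graph :=
  @Graph G cayley_adjacent (fun e => (val e).1) cayley_rev
    cayley_revK cayley_rev_neq.

End Cayley.

Definition peripheral_elements (G : groupType) (PP : set (subgroup G)) : set G :=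
  [set x | x <> 1 /\ exists2 P : subgroup G, PP P & (P : set G) x].

Definition generates (G : groupType) (A : set G) : Prop :=
  forall B : subgroup G, A `<=` B -> (B : set G) = [set: G].

Definition relative_generating_set (G : groupType) (PP : set (subgroup G))
    (S : set G) : Prop :=
  (forall x, S x -> S x^-1) /\
  generates (S `|` \bigcup_(P in PP) (P : set G)).

Section Metrics.
Local Open Scope ring_scope.

Definition is_metric (R : realType) (T : Type) (d : T -> T -> R) : Prop :=
  [/\ forall x y, 0 <= d x y,
      forall x y, d x y = 0 <-> x = y,
      forall x y, d x y = d y x &
      forall x y z, d x z <= d x y + d y z].

Definition proper_metric (R : realType) (T : Type) (d : T -> T -> R) : Prop :=
  forall x r, finite_set [set y | d x y <= r].

Definition left_invariant (R : realType) (G : groupType) (d : G -> G -> R) : Prop :=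
  forall g x y : G, d (g * x)%g (g * y)%g = d x y.

Definition relatively_quasiconvex (R : realType) (G : groupType)
    (PP : set (subgroup G)) (H : subgroup G) : Prop :=
  exists (S : set G) (d : G -> G -> R) (kappa : R),
    [/\ finite_set S, relative_generating_set PP S &
        [/\ is_metric d, proper_metric d & left_invariant d]] /\
    forall (x y : G) (c : seq (edge (cayley_graph (S `|` peripheral_elements PP)))),
      (H : set G) x -> (H : set G) y ->
      @geodesic (cayley_graph (S `|` peripheral_elements PP)) x c y ->
    forall v : G,
      v \in @path_vertices (cayley_graph (S `|` peripheral_elements PP)) x c ->
    exists2 h, (H : set G) h & d v h <= kappa.

End Metrics.

(* The infinite subgroups [H `&` g P g^-1], as subgroups of the group [H]. *)
Definition peripheral_intersections (G : groupType) (PP : set (subgroup G))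
    (H : subgroup G) : set (subgroup H) :=
  [set Q | infinite_set (Q : set H) /\
     exists (g : G) (P : subgroup G),
       PP P /\ (Q : set H) = [set h | (P : set G) (val h ^ g)]].

Arguments peripheral_intersections {G} PP H _.

Definition induced_peripheral_structure (G : groupType) (PP : set (subgroup G))
    (H : subgroup G) (O : set (subgroup H)) : Prop :=
  conjugacy_representatives (peripheral_intersections PP H) O.

(* Main.v *)
Require Import Defs.
From mathcomp Require Import all_boot all_order all_algebra.
From mathcomp Require Import boolp classical_sets functions cardinality reals.
From mathcomp Require Import zify.

(** Let [K] be a fine hyperbolic graph on which [G] acts as in the definition of
relative hyperbolicity. After hanging a leaf on each point of an orbit one may assume
that some vertex [o] has trivial stabilizer ([relatively_hyperbolic_pointed]), so that
[G] sits inside [K] as the orbit of [o]. For a finite relative generating set [S] the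
Cayley graph over [S] and the peripheral subgroups embeds quasi-isometrically in [K]
by [g |-> g o] ([relative_cayley_lipschitz], [relative_cayley_dist_le]): an edge of
[K] is one of finitely many up to translation, and an infinite vertex stabilizer is
peripheral up to conjugation.

The coned-off Cayley graph, where [g o] is joined to [g s o] and to the vertex
[g (cone P)] with stabilizer [g P g^-1], inherits fineness from [K]
([orbit_graph_fine]). Fineness says that every edge at a vertex makes a bounded angle
with only finitely many others; a path of the coned-off graph that avoids a vertex
becomes, in [K], a path that meets this vertex boundedly often, each time in one of
finitely many ways up to translation.

Let [H] be quasiconvex. The elements of [G] on geodesics between points of [H] form
finitely many [H]-orbits; with their neighbours they span a connected subgraph of the
coned-off graph, the hull, that is undistorted in [K] ([hull_undistorted]). Since
quasi-geodesics of a hyperbolic graph stay close to geodesics, the hull is hyperbolic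
([hyperbolic_qi_embedding]), and it is fine as a subgraph of a fine graph. If [H] meets
[g P g^-1] in an infinite group, this group moves a fixed path from [g (cone P)] to [o]
to infinitely many paths whose ends are at bounded distance in the hull; a hull that
avoids [g (cone P)] would thus make infinitely many bounded angles at this vertex, so
the hull contains it ([hull_contains_cone]). Hence the action of [H] on its hull shows
that [H] is hyperbolic relative to the induced peripheral structure.

For intersections the point is to use one generating set for both subgroups. Let [g] be
a vertex of a geodesic, for another generating set, between points of [H]. From [g] one
reaches the hull of [H] in bounded time forwards and backwards along the geodesic, since
both geodesics are quasi-geodesics of [K], and the two routes meet only in [g]. Closed up
inside the hull they contain a circuit of bounded length through [g] and an edge of the
hull, and fineness leaves finitely many possibilities for [g] modulo [H]
([hull_two_routes], [hull_of_other_generators]). With a common generating set it remains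
that an element close to both [H1] and [H2] is close to their intersection
([intersection_translates]). *)

Set Implicit Arguments.
Unset Strict Implicit.
Unset Printing Implicit Defensive.
Import Order.TTheory GRing.Theory Num.Theory.
Local Open Scope classical_set_scope.

(** * Paths, distances and geodesics *)

Section Paths.
Variable K : graph.
Implicit Types (x y z v w : vertex K) (e f : edge K) (p q r c : seq (edge K)).

Lemma tgt_erev e : tgt (erev e) = src e.
Proof. by rewrite /tgt erevK. Qed.

Lemma edge_path_cons x e p y :
  edge_path x (e :: p) y = (src e = x /\ edge_path (tgt e) p y).
Proof. by []. Qed.

Lemma path_vertices_cons x e p :
  path_vertices x (e :: p) = x :: path_vertices (tgt e) p.
Proof. by []. Qed.

Lemma edge_path_cat x p q y :
  edge_path x (p ++ q) y <-> exists2 z, edge_path x p z & edge_path z q y.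
Proof.
elim: p x => [|e p IH] x /=.
  by split=> [pq|[z <-]]; [exists x|].
split=> [[ex /IH[z pz zq]]|[z [ex pz] zq]]; first by exists z.
by split=> //; apply/IH; exists z.
Qed.

Lemma edge_path_catI x p z q y :
  edge_path x p z -> edge_path z q y -> edge_path x (p ++ q) y.
Proof. by move=> pz zq; apply/edge_path_cat; exists z. Qed.

Lemma edge_path_rcons x p e y :
  edge_path x (rcons p e) y <-> edge_path x p (src e) /\ tgt e = y.
Proof.
rewrite -cats1 edge_path_cat /=; split; first by case=> z px [ez <-]; rewrite ez.
by case=> px ey; exists (src e).
Qed.

Lemma edge_path_last x p y : edge_path x p y -> last x (map (@tgt K) p) = y.
Proof. by elim: p x => [|e p IH] x //= [_ /IH]. Qed.

Lemma edge_path_inj x p y z : edge_path x p y -> edge_path x p z -> y = z.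
Proof. by move=> /edge_path_last <- /edge_path_last <-. Qed.

Definition rev_path p := rev (map (@erev K) p).

Lemma size_rev_path p : size (rev_path p) = size p.
Proof. by rewrite size_rev size_map. Qed.

Lemma edge_path_rev x p y : edge_path x p y -> edge_path y (rev_path p) x.
Proof.
elim: p x => [|e p IH] x /=; first by move->.
move=> [ex /IH pe]; rewrite /rev_path /= rev_cons; apply/edge_path_rcons.
by rewrite tgt_erev; split.
Qed.

Lemma mem_rev_path e p : (e \in rev_path p) = (erev e \in p).
Proof.
rewrite mem_rev; apply/mapP/idP=> [[f fp ->]|ep]; first by rewrite erevK.
by exists (erev e); rewrite ?erevK.
Qed.

Lemma mem_path_end x p y : edge_path x p y -> y \in path_vertices x p.
Proof. by move=> /edge_path_last <-; rewrite mem_last. Qed.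

Lemma path_vertices_cat x p z q : edge_path x p z ->
  path_vertices x (p ++ q) = path_vertices x p ++ map (@tgt K) q.
Proof. by rewrite /path_vertices map_cat. Qed.

Lemma mem_path_vertices_cat x p z q v : edge_path x p z ->
  (v \in path_vertices x (p ++ q)) =
  (v \in path_vertices x p) || (v \in path_vertices z q).
Proof.
move=> pz; rewrite (path_vertices_cat _ pz) mem_cat [_ \in path_vertices z q]inE.
by case: eqP => // ->; rewrite (mem_path_end pz).
Qed.

Lemma path_vertices_src x p y : edge_path x p y ->
  path_vertices x p = rcons (map (@src K) p) y.
Proof.
elim: p x => [|e p IH] x /=; first by move->.
by move=> [<- /IH]; rewrite /path_vertices /= => ->.
Qed.

Lemma path_vertices_rev x p y : edge_path x p y ->
  path_vertices y (rev_path p) = rev (path_vertices x p).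
Proof.
move=> pxy; rewrite (path_vertices_src pxy) rev_rcons /path_vertices /rev_path.
by rewrite map_rev -map_comp; congr (_ :: rev _); apply: eq_map => e /=; rewrite tgt_erev.
Qed.

Lemma mem_path_rev x p y v : edge_path x p y ->
  (v \in path_vertices y (rev_path p)) = (v \in path_vertices x p).
Proof. by move=> pxy; rewrite (path_vertices_rev pxy) mem_rev. Qed.

Lemma mem_path_src x p y e : edge_path x p y -> e \in p -> src e \in path_vertices x p.
Proof.
move=> pxy ep; rewrite (path_vertices_src pxy) mem_rcons inE; apply/orP; right.
exact: map_f.
Qed.

Lemma path_split x p y v : edge_path x p y -> v \in path_vertices x p ->
  exists p1 p2, [/\ p = p1 ++ p2, edge_path x p1 v & edge_path v p2 y].
Proof.
elim: p x => [|e p IH] x /=.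
  by move=> <-; rewrite inE => /eqP->; exists [::], [::].
move=> [ex pe]; rewrite inE => /predU1P[->|vp]; first by exists [::], (e :: p).
have [p1 [p2 [-> ep1 vp2]]] := IH _ pe vp.
by exists (e :: p1), p2.
Qed.

Lemma path_nth x p y k : edge_path x p y -> k <= size p ->
  edge_path x (take k p) (nth x (path_vertices x p) k) /\
  edge_path (nth x (path_vertices x p) k) (drop k p) y.
Proof.
elim: p x k => [|e p IH] x [|k] //= [ex pe] // kp.
have [p1 p2] := IH _ k pe kp.
by rewrite (set_nth_default (tgt e)) /= ?size_map.
Qed.

Lemma path_nth_edge x p y i : edge_path x p y -> i < size p ->
  exists2 e, src e = nth x (path_vertices x p) i & tgt e = nth x (path_vertices x p) i.+1.
Proof.
elim: p x i => [|e p IH] x [|i] //; rewrite edge_path_cons => -[ex pe] ip.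
  by exists e.
have [f fi fj] := IH _ i pe ip; exists f; rewrite ?fi ?fj.
  by rewrite [RHS](set_nth_default (tgt e)) //= size_map (leq_trans ip).
by rewrite [RHS](set_nth_default (tgt e)) //= size_map.
Qed.

(** Deleting the excursions between repeated vertices makes a path simple. *)
Lemma simple_path x p y : edge_path x p y ->
  exists q, [/\ edge_path x q y, size q <= size p, uniq (path_vertices x q),
                {subset q <= p} & {subset path_vertices x q <= path_vertices x p}].
Proof.
elim: p x => [|e p IH] x /=; first by move=> <-; exists [::]; split.
move=> [ex pe]; have [q [qe sq uq qp vq]] := IH _ pe.
have [xq|xq] := boolP (x \in path_vertices (tgt e) q).
  have [q1 [q2 [qE q1x q2y]]] := path_split qe xq.
  have sub : {subset path_vertices x q2 <= path_vertices (tgt e) q}.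
    by move=> v vq2; rewrite qE (mem_path_vertices_cat _ _ q1x) vq2 orbT.
  exists q2; split=> //.
  - by move: sq; rewrite qE size_cat; lia.
  - move: uq; rewrite qE (path_vertices_cat _ q1x) cat_uniq => /and3P[_ dis u2].
    rewrite /path_vertices /= u2 andbT; apply/negP => xq2; case/negP: dis.
    by apply/hasP; exists x => //; apply: mem_path_end q1x.
  - by move=> f fq2; rewrite inE qp ?orbT// qE mem_cat fq2 orbT.
  - by move=> v /sub /vq vp; rewrite inE vp orbT.
exists (e :: q); split=> //=.
- by rewrite xq.
- by move=> f; rewrite !inE => /orP[->//|/qp ->]; rewrite orbT.
- by move=> v; rewrite !inE => /orP[->//|/vq]; rewrite inE => ->; rewrite orbT.
Qed.

Lemma first_visit (A : set (vertex K)) x p y : edge_path x p y -> A y ->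
  exists q z, [/\ edge_path x q z, A z, size q <= size p,
     {subset path_vertices x q <= path_vertices x p} &
     forall e, e \in q -> ~ A (src e)].
Proof.
elim: p x => [|e p IH] x /=; first by move=> -> Ay; exists [::], y; split.
move=> [ex pe] Ay; have [Ax|nAx] := pselect (A x).
  by exists [::], x; split=> // v; rewrite inE => /eqP->; rewrite mem_head.
have [q [z [qz Az sq vq nA]]] := IH _ pe Ay.
exists (e :: q), z; split=> //=.
- by move=> v; rewrite inE => /orP[/eqP->|/vq vp]; [exact: mem_head|rewrite inE vp orbT].
- by move=> f; rewrite inE => /orP[/eqP->|/nA//]; rewrite ex.
Qed.

Lemma subpath x p y i j : edge_path x p y -> i <= j <= size p ->
  let v := nth x (path_vertices x p) in
  exists q, [/\ edge_path (v i) q (v j), size q = j - i,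
    forall w, w \in path_vertices (v i) q -> exists2 k, i <= k <= j & w = v k &
    forall e, e \in q -> exists2 k, i <= k < j & src e = v k /\ tgt e = v k.+1].
Proof.
move=> pxy ijp v; have [d] : exists d, j = i + d by exists (j - i); lia.
elim: d j ijp => [|d IH] j ijp jE.
  exists [::]; rewrite jE addn0 subnn; split=> // w; rewrite inE => /eqP->.
  by exists i => //; rewrite leqnn.
have [||q [q1 q2 q3 q4]] := IH (i + d); [lia|by []|].
have [|e es et] := @path_nth_edge x p y (i + d) pxy; first by lia.
exists (rcons q e); rewrite jE addnS; split.
- by rewrite edge_path_rcons es et.
- by rewrite size_rcons q2; lia.
- move=> w; rewrite -cats1 (path_vertices_cat _ q1) mem_cat => /orP[/q3[k hk ->]|].
    by exists k => //; lia.
  by rewrite /= inE => /eqP->; exists (i + d).+1; [lia|rewrite et].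
- move=> f; rewrite mem_rcons inE => /orP[/eqP->|/q4[k hk fk]]; last by exists k => //; lia.
  by exists (i + d); [lia|split].
Qed.

(** ** Distances *)

Lemma within_refl x : within_distance 0 x x.
Proof. by exists [::]. Qed.

Lemma within_sym n x y : within_distance n x y -> within_distance n y x.
Proof.
by move=> [p pxy pn]; exists (rev_path p); [apply: edge_path_rev|rewrite size_rev_path].
Qed.

Lemma within_trans m n x y z :
  within_distance m x y -> within_distance n y z -> within_distance (m + n) x z.
Proof.
move=> [p pxy pm] [q qyz qn]; exists (p ++ q); first exact: edge_path_catI qyz.
by rewrite size_cat leq_add.
Qed.

Lemma within_mono m n x y : m <= n -> within_distance m x y -> within_distance n x y.
Proof. by move=> mn [p pxy pm]; exists p => //; apply: leq_trans mn. Qed.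

Definition reachable x y : Prop := exists n, `[< within_distance n x y >].

(** Vertices in different components get the junk distance [0]. *)
Definition dist x y : nat :=
  if pselect (reachable x y) is left ex then ex_minn ex else 0.

Lemma dist_le n x y : within_distance n x y -> dist x y <= n.
Proof.
move=> /asboolP xyn; rewrite /dist; case: pselect => // ex.
by case: ex_minnP => m _; apply.
Qed.

Lemma dist_size x p y : edge_path x p y -> dist x y <= size p.
Proof. by move=> pxy; apply: dist_le; exists p. Qed.

Lemma dist_reach n x y : within_distance n x y -> within_distance (dist x y) x y.
Proof.
move=> /asboolP xyn; rewrite /dist; case: pselect => [ex|[]]; last by exists n.
by case: ex_minnP => m /asboolP.
Qed.

Lemma distxx x : dist x x = 0.
Proof. by apply/eqP; rewrite -leqn0; apply/dist_le/within_refl. Qed.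

Lemma dist_sym x y : dist x y = dist y x.
Proof.
wlog: x y / reachable x y => [W|[n /asboolP xyn]].
  have [/W//|nxy] := pselect (reachable x y).
  have [/W->//|nyx] := pselect (reachable y x).
  by rewrite /dist; case: pselect => //; case: pselect.
apply/eqP; rewrite eqn_leq; apply/andP; split; apply/dist_le/within_sym.
  exact/dist_reach/within_sym/xyn.
exact/dist_reach/xyn.
Qed.

Section Connected.
Hypothesis conn : connected_graph K.

Lemma within_dist x y : within_distance (dist x y) x y.
Proof.
have [p pxy] := conn.2 x y; apply: (@dist_reach (size p)).
by exists p.
Qed.

Lemma dist_triangle y x z : dist x z <= dist x y + dist y z.
Proof. exact/dist_le/within_trans/within_dist/within_dist. Qed.

Lemma dist_path x y : exists2 p, edge_path x p y & size p = dist x y.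
Proof.
have [p pxy ps] := within_dist x y; exists p => //.
by apply/eqP; rewrite eqn_leq ps dist_size.
Qed.

Lemma geodesicP x p y : geodesic x p y <-> edge_path x p y /\ size p = dist x y.
Proof.
split=> -[pxy geo]; split=> //; last by move=> q /dist_size; rewrite geo.
apply/eqP; rewrite eqn_leq dist_size // andbT.
by have [q /geo sq <-] := dist_path x y.
Qed.

Lemma geodesic_ex x y : exists p, geodesic x p y.
Proof. by have [p pxy ps] := dist_path x y; exists p; apply/geodesicP. Qed.

End Connected.

Lemma geodesic_rev x p y : geodesic x p y -> geodesic y (rev_path p) x.
Proof.
move=> [pxy geo]; split; first exact: edge_path_rev.
by move=> q /edge_path_rev /geo; rewrite !size_rev_path.
Qed.

Lemma geodesic_cat x p q y : geodesic x (p ++ q) y ->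
  exists z, geodesic x p z /\ geodesic z q y.
Proof.
move=> [/edge_path_cat[z pz zq] geo]; exists z; split; split=> // r rz.
  by have := geo _ (edge_path_catI rz zq); rewrite !size_cat leq_add2r.
by have := geo _ (edge_path_catI pz rz); rewrite !size_cat leq_add2l.
Qed.

Lemma geodesic_uniq x p y : geodesic x p y -> uniq (path_vertices x p).
Proof.
move=> [pxy geo]; have [q [qxy sq uq qp vq]] := simple_path pxy.
apply: leq_size_uniq uq vq _.
by rewrite /= ltnS !size_map geo.
Qed.

Lemma geodesic_dist_end x p y : geodesic x p y -> dist x y = size p.
Proof.
move=> [pxy geo]; apply/eqP; rewrite eqn_leq dist_size //=.
have : within_distance (size p) x y by exists p.
by move=> /dist_reach[q /geo]; apply: leq_trans.
Qed.

Lemma geodesic_nth_dist x p y i j : geodesic x p y -> i <= j <= size p ->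
  dist (nth x (path_vertices x p) i) (nth x (path_vertices x p) j) = j - i.
Proof.
move=> geo /andP[ij jp].
have pE : p = (take i p ++ take (j - i) (drop i p)) ++ drop j p.
  by rewrite -takeD subnKC // cat_take_drop.
have /path_nth pn := geo.1.
move: geo; rewrite {1}pE => /geodesic_cat[z [g1 _]].
have [w [g2 g3]] := geodesic_cat g1.
have -> : nth x (path_vertices x p) i = w.
  by apply: edge_path_inj g2.1; case: (pn i (leq_trans ij jp)).
have -> : nth x (path_vertices x p) j = z.
  apply: edge_path_inj g1.1; rewrite -takeD subnKC //; by case: (pn j jp).
by rewrite (geodesic_dist_end g3) size_takel // size_drop; lia.
Qed.

End Paths.

(** * Quasi-geodesics in hyperbolic graphs *)

Lemma exp_beats_linear a b : exists k0, forall k, k0 <= k -> a * k + b <= 2 ^ k.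
Proof.
exists (2 * (2 * a + b)) => k kk0.
pose m := k./2; have kE : k = odd k + m.*2 by rewrite odd_double_half.
have m1 : m < 2 ^ m by apply: ltn_expl.
have m2 : (m.+1) * (m.+1) <= 2 ^ k.
  rewrite kE -addnn !expnD; apply: leq_trans (leq_pmull _ _); last by rewrite expn_gt0.
  exact: leq_mul.
apply: leq_trans m2; have : 2 * a + b <= m.+1 by lia.
move: kE; case: (odd k) => /= kE; nia.
Qed.

(** A number [D] that is at most [d] times the binary logarithm of a linear function
of [D], up to a constant, is bounded. *)
Lemma log_gap a b d c : exists M, forall D, M < D ->
  exists k, a * D + b <= 2 ^ k /\ d * k + c < D.
Proof.
have [k0 hk0] := exp_beats_linear (a * d.+1) (a * d.+1 + a * c.+1 + b).
exists (c + k0 * d.+1) => D MD; pose k := (D - c).-1 %/ d.+1.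
have kk0 : k0 <= k by rewrite leq_divRL //; lia.
have e := divn_eq (D - c).-1 d.+1; have r := ltn_pmod (D - c).-1 (ltn0Sn d).
exists k; rewrite -/k in e; split; last by nia.
apply: leq_trans (hk0 k kk0).
have : D <= d.+1 * k + d.+1 + c.+1 by nia.
by move=> /(leq_mul (leqnn a)); nia.
Qed.

Section Morse.
Variables (K : graph) (delta : nat).
Hypotheses (conn : connected_graph K) (hyp : hyperbolic_graph K delta).
Implicit Types (x y z v w : vertex K) (p q r : seq (edge K)) (c : nat -> vertex K).

Let tri := dist_triangle conn.

(** Cut the path into two halves: slimness of the triangle formed by the geodesic and
the geodesics spanned by the halves costs [delta], so the distance is at most [delta]
times the number of halvings. *)
Lemma geodesic_near_short_path k x p q y v :
  edge_path x p y -> size p <= 2 ^ k -> geodesic x q y -> v \in path_vertices x q ->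
  exists2 w, w \in path_vertices x p & dist v w <= delta * k.
Proof.
elim: k x p q y v => [|k IH] x p q y v pxy.
  rewrite expn0 => sp qxy vq; exists v; last by rewrite distxx.
  have := qxy.2 _ pxy; case: q qxy vq => [|e [|f q]] /= [qxy _].
  - by rewrite inE => /eqP->; rewrite mem_head.
  - move: qxy => /= [_ ey]; rewrite !inE => /orP[/eqP->|/eqP-> _]; first by rewrite eqxx.
    by rewrite ey; apply: mem_path_end.
  - by lia.
move=> sp qxy vq.
have /edge_path_cat[z p1 p2] : edge_path x (take (2 ^ k) p ++ drop (2 ^ k) p) y.
  by rewrite cat_take_drop.
have s1 : size (take (2 ^ k) p) <= 2 ^ k by rewrite size_take; case: ltnP => // /ltnW.
have s2 : size (drop (2 ^ k) p) <= 2 ^ k.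
  by rewrite size_drop leq_subLR addnn -mul2n -expnS.
have [q1 g1] := geodesic_ex conn x z; have [q2 g2] := geodesic_ex conn z y.
have [w] := hyp qxy (geodesic_rev g2) g1 vq.
have pV u : (u \in path_vertices x p) =
    (u \in path_vertices x (take (2 ^ k) p)) || (u \in path_vertices z (drop (2 ^ k) p)).
  by rewrite -(mem_path_vertices_cat _ _ p1) cat_take_drop.
rewrite mem_cat (mem_path_rev _ g2.1) => /orP[] wq /dist_le vw.
- have [u up wu] := IH _ _ _ _ _ p2 s2 g2 wq.
  by exists u; [rewrite pV up orbT|have := tri w v u; rewrite mulnS; lia].
- have [u up wu] := IH _ _ _ _ _ p1 s1 g1 wq.
  by exists u; [rewrite pV up|have := tri w v u; rewrite mulnS; lia].
Qed.

(** A quasi-geodesic with points [c 0, ..., c n]. Only consecutive points are required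
to be close: the linear upper bound on all distances follows. *)
Definition quasigeodesic C n c : Prop :=
  (forall i, i < n -> dist (c i) (c i.+1) <= C) /\
  (forall i j, i <= j <= n -> j - i <= C * dist (c i) (c j) + C).

Lemma quasigeodesic_gap C n c i j : quasigeodesic C n c -> i <= n -> j <= n ->
  (j - i) + (i - j) <= C * dist (c i) (c j) + C.
Proof.
move=> [_ qg] ni nj; have [ij|ji] := leqP i j.
  by have := qg i j; rewrite ij nj; lia.
by rewrite dist_sym; have := qg j i; rewrite (ltnW ji) ni; lia.
Qed.

(** Consecutive points of a quasi-geodesic need not be adjacent; joining them by
geodesics gives a path to which the estimates on path lengths apply. *)
Lemma interpolating_path C c i j : i <= j ->
  (forall k, i <= k < j -> dist (c k) (c k.+1) <= C) ->
  exists p, [/\ edge_path (c i) p (c j), size p <= C * (j - i) &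
    forall w, w \in path_vertices (c i) p -> exists2 k, i <= k <= j & dist w (c k) <= C].
Proof.
elim: j => [|j IH] ij hC.
  have -> : i = 0 by lia.
  exists [::]; split => // w; rewrite inE => /eqP->; exists 0 => //.
  by rewrite distxx.
have [->|nij] := eqVneq i j.+1.
  exists [::]; split => // w; rewrite inE => /eqP->; exists j.+1; first by lia.
  by rewrite distxx.
have [|k hk|p [p1 p2 p3]] := IH; [lia|by apply: hC; lia|].
have [q q1 q2] := dist_path conn (c j) (c j.+1).
have jC := hC j; have {jC} jC : dist (c j) (c j.+1) <= C by apply: jC; lia.
exists (p ++ q); split; first exact: edge_path_catI q1.
  rewrite size_cat q2 (_ : j.+1 - i = (j - i).+1); last by lia.
  by rewrite mulnS; lia.
move=> w; rewrite (mem_path_vertices_cat _ _ p1) => /orP[/p3[k hk wk]|wq].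
  by exists k => //; lia.
exists j; first by lia.
have [r1 [r2 [qE r1w _]]] := path_split q1 wq.
have := dist_size r1w; rewrite dist_sym; move: q2; rewrite qE size_cat; lia.
Qed.

Lemma interpolating_path_sym C n c i j : quasigeodesic C n c -> i <= n -> j <= n ->
  exists p, [/\ edge_path (c i) p (c j), size p <= C * (C * dist (c i) (c j) + C) &
    forall w, w \in path_vertices (c i) p -> exists2 k, k <= n & dist w (c k) <= C].
Proof.
move=> qg ni nj; have gap := quasigeodesic_gap qg ni nj.
have [ij|ji] := leqP i j.
  have [k hk|p [p1 p2 p3]] := @interpolating_path C c i j ij; first by apply: qg.1; lia.
  exists p; split => // [|w /p3[k hk wk]]; last by exists k => //; lia.
  by apply: leq_trans p2 _; apply: leq_mul => //; lia.
have [k hk|p [p1 p2 p3]] := @interpolating_path C c j i (ltnW ji); first by apply: qg.1; lia.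
exists (rev_path p); split; first exact: edge_path_rev.
  by rewrite size_rev_path; apply: leq_trans p2 _; apply: leq_mul => //; lia.
by move=> w; rewrite (mem_path_rev _ p1) => /p3[k hk wk]; exists k => //; lia.
Qed.

(** Let [D] be the largest distance from a point [v0] of the geodesic to the
quasi-geodesic. Leave the geodesic at distance [2 D] before [v0], follow the
quasi-geodesic, and come back at distance [2 D] after [v0]: this detour has length
linear in [D] but avoids the ball of radius [D] about [v0] up to a constant, while
a geodesic point is within a logarithm of the detour. So [D] is bounded. *)
Lemma geodesic_near_quasigeodesic C : exists M, forall n c q v,
  quasigeodesic C n c -> geodesic (c 0) q (c n) -> v \in path_vertices (c 0) q ->
  exists2 k, k <= n & dist v (c k) <= M.
Proof.
have [M hM] := log_gap (2 + 6 * C * C) (C * C) delta C.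
exists M => n c q v qg geo vq.
pose far D := `[< exists2 v, v \in path_vertices (c 0) q &
                    forall k, k <= n -> D <= dist v (c k) >].
have far0 : exists D, far D by exists 0; apply/asboolP; exists v.
have farb D : far D -> D <= size q.
  move=> /asboolP[w wq /(_ 0 isT) hw]; apply: leq_trans hw _; rewrite dist_sym.
  have [r1 [r2 [-> r1w _]]] := path_split geo.1 wq.
  by rewrite size_cat; apply: leq_trans (dist_size r1w) _; apply: leq_addr.
case: (ex_maxnP far0 farb) => D /asboolP[v0 v0q v0D] Dmax.
have near w : w \in path_vertices (c 0) q -> exists2 k, k <= n & dist w (c k) <= D.
  move=> wq; apply: contrapT => nk.
  have /Dmax : far D.+1; last by rewrite ltnn.
  apply/asboolP; exists w => // k kn; rewrite ltnNge; apply/negP => wk.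
  by apply: nk; exists k.
suff DM : D <= M.
  by have [k kn vk] := near v vq; exists k => //; apply: leq_trans DM.
rewrite leqNgt; apply/negP => /hM[k [hk1 hk2]].
set s := path_vertices (c 0) q in v0q near.
have s_size : size s = (size q).+1 by rewrite /= size_map.
pose t := index v0 s; have ts : t <= size q by rewrite -ltnS -s_size index_mem.
have v0E : nth (c 0) s t = v0 by rewrite nth_index.
pose t1 := t - 2 * D; pose t2 := minn (t + 2 * D) (size q).
pose y := nth (c 0) s t1; pose z := nth (c 0) s t2.
have dyz : dist y z <= 4 * D.
  by rewrite (geodesic_nth_dist geo) /t1 /t2; lia.
have dyv : dist y v0 = t - t1 by rewrite -v0E (geodesic_nth_dist geo) // /t1; lia.
have dvz : dist v0 z = t2 - t by rewrite -v0E (geodesic_nth_dist geo) // /t2; lia.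
(* A short path from [u] to the quasi-geodesic that stays far from [v0]. *)
have leg u ku : u \in s -> ku <= n -> (u = c ku \/ dist v0 u = 2 * D) ->
    exists2 k', k' <= n & exists p, [/\ edge_path u p (c k'), size p <= D &
      forall w, w \in path_vertices u p -> D <= dist v0 w].
  move=> us kun [->|du].
    by exists ku => //; exists [::]; split=> // w; rewrite inE => /eqP->; apply: v0D.
  have [k' k'n uk'] := near u us.
  have [p p1 p2] := dist_path conn u (c k').
  exists k' => //; exists p; split; rewrite ?p2 // => w wp.
  have [r1 [r2 [pE r1w _]]] := path_split p1 wp.
  have := dist_size r1w; move: p2; rewrite pE size_cat (dist_sym u w).
  by have := tri w v0 u; lia.
have ys : y \in s by rewrite mem_nth // s_size /t1; lia.
have zs : z \in s by rewrite mem_nth // s_size ltnS /t2 geq_minr.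
have [ky kyn [py [py1 py2 py3]]] : exists2 k', k' <= n & exists p,
    [/\ edge_path y p (c k'), size p <= D &
      forall w, w \in path_vertices y p -> D <= dist v0 w].
  apply: (leg y 0) => //; have [l|l] := leqP t (2 * D).
    by left; rewrite /y /t1 (eqP l).
  by right; rewrite dist_sym dyv /t1; lia.
have [kz kzn [pz [pz1 pz2 pz3]]] : exists2 k', k' <= n & exists p,
    [/\ edge_path z p (c k'), size p <= D &
      forall w, w \in path_vertices z p -> D <= dist v0 w].
  apply: (leg z n) => //; have [l|l] := leqP (size q) (t + 2 * D).
    left; rewrite /z /t2 (minn_idPr l) -(edge_path_last geo.1).
    by rewrite (last_nth (c 0)) size_map.
  by right; rewrite dvz /t2; lia.
have [pc [pc1 pc2 pc3]] := interpolating_path_sym qg kyn kzn.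
have dk : dist (c ky) (c kz) <= 6 * D.
  have := tri y (c ky) (c kz); have := tri z y (c kz).
  by have := dist_size py1; have := dist_size pz1; rewrite (dist_sym (c ky) y); lia.
pose p := (py ++ pc) ++ rev_path pz.
have pyc := edge_path_catI py1 pc1.
have pP : edge_path y p z := edge_path_catI pyc (edge_path_rev pz1).
have sp : size p <= 2 ^ k.
  apply: leq_trans hk1; rewrite !size_cat size_rev_path.
  have : C * (C * dist (c ky) (c kz) + C) <= C * (C * (6 * D) + C).
    by rewrite leq_mul2l leq_add2r leq_mul2l dk !orbT.
  by nia.
have [qyz [gyz v0qyz]] : exists r, geodesic y r z /\ v0 \in path_vertices y r.
  have [q2 g2] := geodesic_ex conn y v0.
  have [q3 g3] := geodesic_ex conn v0 z.
  have q23 := edge_path_catI g2.1 g3.1.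
  exists (q2 ++ q3); split; last by rewrite (mem_path_vertices_cat _ _ g2.1) (mem_path_end g2.1).
  apply/(geodesicP conn); split => //.
  rewrite size_cat -(geodesic_dist_end g2) -(geodesic_dist_end g3) dyv dvz.
  by rewrite (geodesic_nth_dist geo) /t1 /t2; lia.
have [w wp vw] := geodesic_near_short_path pP sp gyz v0qyz.
have : D <= dist v0 w + C.
  move: wp; rewrite (mem_path_vertices_cat _ _ pyc) (mem_path_vertices_cat _ _ py1).
  rewrite (mem_path_rev _ pz1) => /orP[/orP[/py3|/pc3[k' k'n wk']]|/pz3]; try lia.
  by have := v0D _ k'n; have := tri w v0 (c k'); lia.
by lia.
Qed.

(** Points of the geodesic are close to the quasi-geodesic, first to points before
[c i] and at the end to points after [c i]. Where this changes, points on both sides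
of [c i] are close to each other, hence to [c i]. *)
Lemma quasigeodesic_near_geodesic C : exists M, forall n c q i,
  quasigeodesic C n c -> geodesic (c 0) q (c n) -> i <= n ->
  exists2 v, v \in path_vertices (c 0) q & dist (c i) v <= M.
Proof.
have [D hD] := geodesic_near_quasigeodesic C.
exists (D + C * (C * (2 * D + 1) + C)) => n c q i qg geo ni.
set s := path_vertices (c 0) q.
have s_size : size s = (size q).+1 by rewrite /= size_map.
have far j k : j <= n -> k <= i <= j -> dist (c k) (c j) <= 2 * D + 1 ->
    dist (c i) (c k) <= C * (C * (2 * D + 1) + C).
  move=> jn /andP[ki ij] d; rewrite dist_sym.
  have [k' hk'|p [p1 p2 _]] := @interpolating_path C c k i ki; first by apply: qg.1; lia.
  apply: leq_trans (dist_size p1) (leq_trans p2 _); rewrite leq_mul2l; apply/orP; right.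
  have h1 := qg.2 k j; have {h1} : j - k <= C * dist (c k) (c j) + C by apply: h1; lia.
  have : C * dist (c k) (c j) <= C * (2 * D + 1) by rewrite leq_mul2l d orbT.
  by lia.
pose A t := `[< t <= size q /\ exists2 k, k <= i & dist (nth (c 0) s t) (c k) <= D >].
have A0 : exists t, A t.
  by exists 0; apply/asboolP; split => //; exists 0 => //=; rewrite distxx.
have Ab t : A t -> t <= size q by move=> /asboolP[].
case: (ex_maxnP A0 Ab) => t /asboolP[tq [k ki tk]] tmax.
have [ts|ts] := eqVneq t (size q).
  have tn : nth (c 0) s t = c n.
    by rewrite ts -(edge_path_last geo.1) (last_nth (c 0)) size_map.
  exists (c n); first exact: mem_path_end geo.1.
  rewrite tn in tk; have d : dist (c k) (c n) <= 2 * D + 1 by rewrite dist_sym; lia.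
  have kin : k <= i <= n by rewrite ki.
  have := far n k (leqnn n) kin d; have := tri (c k) (c i) (c n).
  by rewrite (dist_sym (c k) (c n)); lia.
have tq' : t.+1 <= size q by lia.
have t1s : nth (c 0) s t.+1 \in s by rewrite mem_nth // s_size.
have [k' k'n tk'] := hD _ _ _ _ qg geo t1s.
have ik' : i < k'.
  rewrite ltnNge; apply/negP => k'i; suff /tmax : A t.+1 by lia.
  by apply/asboolP; split => //; exists k'.
exists (nth (c 0) s t); first by rewrite mem_nth // s_size ltnS.
have d1 : dist (nth (c 0) s t) (nth (c 0) s t.+1) = 1 by rewrite (geodesic_nth_dist geo); lia.
have d : dist (c k) (c k') <= 2 * D + 1.
  have := tri (nth (c 0) s t) (c k) (c k').
  have := tri (nth (c 0) s t.+1) (nth (c 0) s t) (c k').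
  by rewrite (dist_sym (c k) (nth _ _ _)); lia.
have kik : k <= i <= k' by lia.
have := far k' k k'n kik d; have := tri (c k) (c i) (nth (c 0) s t).
by rewrite (dist_sym (c k) (nth _ _ _)); lia.
Qed.

Lemma quasigeodesics_close C : exists M, forall n n' c c' i,
  quasigeodesic C n c -> quasigeodesic C n' c' -> c 0 = c' 0 -> c n = c' n' -> i <= n ->
  exists2 j, j <= n' & dist (c i) (c' j) <= M.
Proof.
have [M1 h1] := geodesic_near_quasigeodesic C.
have [M2 h2] := quasigeodesic_near_geodesic C.
exists (M2 + M1) => n n' c c' i qg qg' c0 cn ni.
have [q geo] := geodesic_ex conn (c 0) (c n).
have [v vq vi] := h2 _ _ _ _ qg geo ni.
rewrite c0 cn in geo vq; have [j jn vj] := h1 _ _ _ _ qg' geo vq.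
by exists j => //; have := tri v (c i) (c' j); lia.
Qed.

Lemma quasigeodesic_triangle C : exists M, forall n1 n2 n3 c1 c2 c3 i,
  quasigeodesic C n1 c1 -> quasigeodesic C n2 c2 -> quasigeodesic C n3 c3 ->
  c1 0 = c3 0 -> c1 n1 = c2 0 -> c2 n2 = c3 n3 -> i <= n1 ->
  (exists2 j, j <= n2 & dist (c1 i) (c2 j) <= M) \/
  (exists2 j, j <= n3 & dist (c1 i) (c3 j) <= M).
Proof.
have [M1 h1] := geodesic_near_quasigeodesic C.
have [M2 h2] := quasigeodesic_near_geodesic C.
exists (M2 + delta + M1) => n1 n2 n3 c1 c2 c3 i qg1 qg2 qg3 e1 e2 e3 ni.
have [q1 g1] := geodesic_ex conn (c1 0) (c1 n1).
have [q2 g2] := geodesic_ex conn (c2 0) (c2 n2).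
have [q3 g3] := geodesic_ex conn (c3 0) (c3 n3).
have [v vq vi] := h2 _ _ _ _ qg1 g1 ni.
have [w] : exists2 w, w \in path_vertices (c2 0) q2 ++ path_vertices (c3 0) q3 &
    within_distance delta v w.
  rewrite e1 e2 in g1 vq; rewrite e3 in g2.
  exact: (hyp g1 g2 g3 vq).
rewrite mem_cat => /orP[] wq /dist_le vw; [left|right].
- have [j jn wj] := h1 _ _ _ _ qg2 g2 wq.
  by exists j => //; have := tri v (c1 i) (c2 j); have := tri w v (c2 j); lia.
- have [j jn wj] := h1 _ _ _ _ qg3 g3 wq.
  by exists j => //; have := tri v (c1 i) (c3 j); have := tri w v (c3 j); lia.
Qed.

(** The image of a geodesic triangle has quasi-geodesic sides, so it is slim, and
distances in [Y] are controlled by those in [K]. *)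
Lemma hyperbolic_qi_embedding (Y : graph) (phi : vertex Y -> vertex K) C :
  connected_graph Y ->
  (forall e : edge Y, dist (phi (src e)) (phi (tgt e)) <= C) ->
  (forall u v : vertex Y, dist u v <= C * dist (phi u) (phi v) + C) ->
  exists delta', hyperbolic_graph Y delta'.
Proof.
move=> connY lip low; have [M hM] := quasigeodesic_triangle C.
exists (C * M + C) => x y z p q r gp gq gr v vp.
pose c (x : vertex Y) (p : seq (edge Y)) (i : nat) := phi (nth x (path_vertices x p) i).
have qg (x1 y1 : vertex Y) (p1 : seq (edge Y)) :
    geodesic x1 p1 y1 -> quasigeodesic C (size p1) (c x1 p1).
  move=> g1; split=> [i ip|i j ij]; last by rewrite -(geodesic_nth_dist g1 ij); apply: low.
  by rewrite /c; have [e <- <-] := path_nth_edge g1.1 ip; apply: lip.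
have cend (x1 y1 : vertex Y) (p1 : seq (edge Y)) : geodesic x1 p1 y1 -> c x1 p1 (size p1) = phi y1.
  by move=> [g1 _]; rewrite /c -(edge_path_last g1) (last_nth x1) size_map.
have vi : index v (path_vertices x p) <= size p.
  by rewrite -ltnS; move: vp; rewrite -index_mem /= size_map.
have := hM _ _ _ _ _ _ _ (qg _ _ _ gp) (qg _ _ _ gq) (qg _ _ _ gr) erefl.
rewrite (cend _ _ _ gp) (cend _ _ _ gq) (cend _ _ _ gr) => /(_ _ erefl erefl vi).
rewrite {1 3}/c nth_index //.
have fin (w : vertex Y) : dist (phi v) (phi w) <= M -> within_distance (C * M + C) v w.
  move=> d; apply: within_mono (within_dist connY v w); apply: leq_trans (low v w) _.
  by rewrite leq_add2r leq_mul2l d orbT.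
move=> [] [j jn /fin vj].
  exists (nth y (path_vertices y q) j) => //.
  by rewrite mem_cat mem_nth //= size_map.
exists (nth x (path_vertices x r) j) => //.
by rewrite mem_cat mem_nth ?orbT //= size_map.
Qed.

End Morse.

(** * Fineness and angles *)

Lemma finite_setS (T : Type) (A B : set T) : finite_set B -> A `<=` B -> finite_set A.
Proof. by move=> fB AB; apply: sub_finite_set fB. Qed.

Lemma finite_bigcup_sub (I T : Type) (D : set I) (F : I -> set T) (A : set T) :
  finite_set D -> (forall i, D i -> finite_set (F i)) ->
  (forall x, A x -> exists2 i, D i & F i x) -> finite_set A.
Proof.
move=> fD fF AF; apply: finite_setS (bigcup_finite fD fF) _ => x /AF[i Di Fi].
by exists i.
Qed.

Lemma finite_path_set (T : eqType) (R : rel T) n e :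
  (forall e, finite_set [set f | R e f]) ->
  finite_set [set d | path R e d /\ size d = n].
Proof.
move=> fR; elim: n e => [|n IH] e.
  by apply: (finite_setS (finite_set1 [::])) => d [_ /size0nil].
apply: (finite_bigcup_sub (fR e) (fun f _ => finite_image (cons f) (IH f))).
by move=> [|f d] /= [] // /andP[ef fd] [dn]; exists f => //; exists d.
Qed.

Lemma sorted_consecutive (T : eqType) (R : rel T) (s : seq T) :
  (forall d1 e f d2, s = d1 ++ e :: f :: d2 -> R e f) -> sorted R s.
Proof.
case: s => // e s; elim: s e => [|f s IH] e //= h; apply/andP; split.
  exact: (h [::] e f s).
by apply: IH => d1 e' f' d2 fs; apply: (h (e :: d1) _ _ d2); rewrite /= fs.
Qed.

Section Fine.
Variable K : graph.
Implicit Types (x y z v w : vertex K) (e f : edge K) (p q r c : seq (edge K)).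

Lemma closed_path_rot x c1 c2 : edge_path x (c1 ++ c2) x ->
  exists z, edge_path z (c2 ++ c1) z.
Proof.
by move=> /edge_path_cat[z p1 p2]; exists z; apply: edge_path_catI p2 p1.
Qed.

Lemma closed_path_rot_edge x c e : edge_path x c x -> e \in c ->
  exists d, [/\ edge_path (tgt e) d (src e), perm_eq (e :: d) c &
     exists2 k, k <= size c & c = rotr k (e :: d)].
Proof.
move=> cx ec; have [c1 [c2 cE]] : exists c1 c2, c = c1 ++ e :: c2.
  by case/splitPr: ec => c1 c2; exists c1, c2.
move: cx; rewrite cE => /closed_path_rot[z /= [<- p]].
exists (c2 ++ c1); split=> //; first by rewrite -cat_cons perm_catC.
exists (size c1); first by rewrite size_cat leq_addr.
by rewrite -cat_cons rotr_size_cat.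
Qed.

(** If [e] and [erev e] both occurred, each would be the successor of the other, as
an edge of the path is determined by its source; the path would have length 2. *)
Lemma circuit_criterion x c : c <> [::] -> edge_path x c x -> uniq (map (@src K) c) ->
  (forall e, c <> [:: e; erev e]) -> circuit c.
Proof.
move=> c0 cx uc nback; split=> //; first by exists x.
move=> e ec; apply/negP => rec.
have [d [dp dc [k kc cE]]] := closed_path_rot_edge cx ec.
have ud : uniq (map (@src K) (e :: d)) by rewrite (perm_uniq (perm_map _ dc)).
have red : erev e \in d.
  by move: rec; rewrite -(perm_mem dc) inE (negPf (erev_neq e)).
case: d => [//|f d] in dp dc cE ud red.
move: dp => /= [fe dp].
have {red} fE : f = erev e.
  move: red; rewrite inE => /orP[/eqP//|red].
  by move: ud; rewrite /= fe => /and3P[_ /mapP[]]; exists (erev e).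
rewrite {}fE tgt_erev in dp cE ud.
case: d => [|g d] in dp dc cE ud.
  have : k = 0 \/ k = 1 \/ k = 2 by rewrite cE size_rotr /= in kc; lia.
  case=> [k0|[k0|k0]]; rewrite {}k0 in cE; first by case: (nback e).
    by case: (nback (erev e)); rewrite erevK.
  by case: (nback e).
by move: dp ud => /= [-> _]; rewrite !inE eqxx !orbT.
Qed.

(** The combinatorial angle at [v] between two edges issuing from [v] is at most [n].
Finiteness of angles is a form of fineness that does not require paths to be simple. *)
Definition angle v n e e' : Prop :=
  [/\ src e = v, src e' = v & exists p,
     [/\ edge_path (tgt e) p (tgt e'), size p <= n & v \notin path_vertices (tgt e) p]].

Definition angle_finite : Prop := forall v n e, finite_set [set e' | angle v n e e'].

(** A path subtending an angle may be taken simple; with the two edges it closes up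
to a circuit. *)
Lemma fine_angle_finite : fine_graph K -> angle_finite.
Proof.
move=> fineK v n e.
pose C m := [set c | [/\ circuit c, size c = m & e \in c]].
have fE (c : seq (edge K)) : finite_set [set f | erev f \in c].
  apply: finite_setS (finite_image (@erev K) (finite_seq c)) _ => f /= fc.
  by exists (erev f) => //; rewrite erevK.
have fU : finite_set (\bigcup_(m in `I_n.+3) \bigcup_(c in C m) [set f | erev f \in c]).
  apply: bigcup_finite => [|m _]; first exact: finite_II.
  by apply: bigcup_finite => [|c _]; [exact: fineK|exact: fE].
apply: (finite_setS (B := _ `|` [set e])).
  by rewrite finite_setU; split; [exact: fU|exact: finite_set1].
move=> e' [ev e'v [p [pe pn vp]]].
have [->|nee] := eqVneq e' e; [by right|left].
have [q [qe sq uq _ vq]] := simple_path pe.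
pose c := e :: rcons q (erev e').
have cx : edge_path v c v by rewrite /= edge_path_rcons tgt_erev.
exists (size c); first by rewrite /= size_rcons; lia.
exists c; last by rewrite /= inE mem_rcons inE eqxx orbT.
split=> //; last by rewrite inE eqxx.
have vq' : v \notin path_vertices (tgt e) q by apply: contra vp => /vq.
apply: (circuit_criterion _ cx) => //.
  by rewrite /= map_rcons -/(tgt e') -(path_vertices_src qe) uq ev vq'.
move=> f [<-]; case: q {sq uq vq qe cx vq' c} => [[/(inv_inj (@erevK K))]|g q [_]].
  by move=> e'e; rewrite e'e eqxx in nee.
by case: q.
Qed.

(** Consecutive edges of a circuit subtend an angle bounded by its length, because the
rest of the circuit avoids their common vertex; so each edge leaves finitely many
choices for the next one. *)
Lemma angle_finite_fine : angle_finite -> fine_graph K.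
Proof.
move=> af n e; pose R f g := `[< angle (tgt f) n (erev f) g >].
have fR f : finite_set [set g | R f g].
  by apply: finite_setS (af (tgt f) n (erev f)) _ => g /asboolP.
have fP := finite_path_set n.-1 e fR.
apply: (@finite_bigcup_sub _ _ `I_n.+1
  (fun k => [set rotr k (e :: d) | d in [set d | path R e d /\ size d = n.-1]])).
- exact: finite_II.
- by move=> k _; apply: finite_image.
move=> c [[_ [x cx] uc _] cn ec].
have [d [dp dc [k kc cE]]] := closed_path_rot_edge cx ec.
exists k; first by rewrite /= ltnS -cn.
exists d => //; split; last by rewrite -cn -(perm_size dc).
apply: (@sorted_consecutive _ R (e :: d)) => d1 f g d2 edE.
have ed : edge_path (src e) (e :: d) (src e) by split.
have ud : uniq (map (@src K) (f :: g :: d2 ++ d1)).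
  by rewrite -!cat_cons (perm_uniq (perm_map _ (permEl (perm_catC _ _)))) -edE
    (perm_uniq (perm_map _ dc)).
have sd : size (f :: g :: d2 ++ d1) = n.
  by rewrite -!cat_cons size_cat addnC -size_cat -edE -cn (perm_size dc).
move: ed; rewrite edE => /closed_path_rot[z /= [<- [gf p]]].
apply/asboolP; split=> //.
exists (rev_path (d2 ++ d1)); rewrite tgt_erev; split; first exact: edge_path_rev.
  by rewrite size_rev_path; move: sd => /=; lia.
rewrite (mem_path_rev _ p) (path_vertices_src p) mem_rcons inE -gf.
by move: ud; rewrite /= inE negb_or => /and3P[/andP[fg _] gd _]; rewrite negb_or eq_sym fg.
Qed.

End Fine.

(** Circuits are mapped to circuits, injectively. *)
Lemma fine_graph_embedding (Y X : graph) (i : vertex Y -> vertex X) (j : edge Y -> edge X) :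
  injective i -> injective j -> (forall e, src (j e) = i (src e)) ->
  (forall e, erev (j e) = j (erev e)) -> fine_graph X -> fine_graph Y.
Proof.
move=> inji injj jsrc jrev fineX n e.
have jpath x p y : edge_path x p y -> edge_path (i x) (map j p) (i y).
  elim: p x => [x <-//|f p IH] x /= [fx /IH]; rewrite jsrc fx; split=> //.
  by rewrite /tgt jrev jsrc.
apply: (@finite_setS _ _ ((map j) @^-1` [set c | [/\ circuit c, size c = n & j e \in c]])).
  by apply: finite_preimage => // c c' _ _; apply: inj_map.
move=> c [[c0 [x cx] uc nr] cn ec] /=; split; last by rewrite mem_map.
  split.
  - by case: c c0 {cx uc nr cn ec}.
  - by exists (i x); apply: jpath.
  - rewrite -map_comp (_ : map _ c = map i (map (@src Y) c)); first by rewrite map_inj_uniq.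
    by rewrite -map_comp; apply: eq_map => f /=; apply: jsrc.
  - by move=> f /mapP[g gc ->]; rewrite jrev mem_map // nr.
by rewrite size_map.
Qed.

(** * A vertex with trivial stabilizer *)

Local Open Scope group_scope.

(** A (G, PP)-graph together with a vertex [o] of trivial stabilizer, so that
[g |-> g o] embeds [G] into the graph. *)
Record pointed_action (G : groupType) (PP : set (subgroup G)) (K : graph)
    (a : graph_action G K) (o : vertex K) : Prop := PointedAction {
  pa_connected : connected_graph K;
  pa_hyperbolic : exists delta, hyperbolic_graph K delta;
  pa_fine : fine_graph K;
  pa_edge_stabilizer : forall e : edge K, finite_set (edge_stabilizer a e);
  pa_edge_orbits : finite_set (range (edge_orbit a));
  pa_representatives : conjugacy_representatives (infinite_vertex_stabilizers a) PP;
  pa_free : forall g, vact a g o = o -> g = 1 }.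

Section LeafGraph.
Variables (G : groupType) (K : graph) (a : graph_action G K) (v0 : vertex K).

(** A leaf is hung on [g v0] for each [g] in [G]: the group acts freely on the leaves,
and no circuit is created. *)
Definition leaf_vertex : choiceType := (vertex K + G)%type.
Definition leaf_edge : choiceType := (edge K + G * bool)%type.

Definition leaf_src (e : leaf_edge) : leaf_vertex :=
  match e with
  | inl e => inl (src e)
  | inr (g, b) => if b then inl (vact a g v0) else inr g
  end.

Definition leaf_erev (e : leaf_edge) : leaf_edge :=
  match e with
  | inl e => inl (erev e)
  | inr (g, b) => inr (g, ~~ b)
  end.

Lemma leaf_erevK : involutive leaf_erev.
Proof. by move=> [e|[g []]] //=; rewrite erevK. Qed.

Lemma leaf_erev_neq e : leaf_erev e != e.
Proof.
case: e => [e|[g b]] /=; apply/eqP => -[].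
  by move/eqP; rewrite (negPf (erev_neq e)).
by case: b.
Qed.

Definition leaf_graph : graph := @Graph leaf_vertex leaf_edge leaf_src leaf_erev
  leaf_erevK leaf_erev_neq.

Definition leaf_vact (h : G) (v : vertex leaf_graph) : vertex leaf_graph :=
  match v with inl v => inl (vact a h v) | inr g => inr (h * g) end.

Definition leaf_eact (h : G) (e : edge leaf_graph) : edge leaf_graph :=
  match e with inl e => inl (eact a h e) | inr (g, b) => inr (h * g, b) end.

Lemma leaf_vact1 v : leaf_vact 1 v = v.
Proof. by case: v => [v|g] /=; rewrite ?vact1 ?mul1g. Qed.

Lemma leaf_vactM g h v : leaf_vact (g * h) v = leaf_vact g (leaf_vact h v).
Proof. by case: v => [v|k] /=; rewrite ?vactM ?mulgA. Qed.

Lemma leaf_eact1 e : leaf_eact 1 e = e.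
Proof. by case: e => [e|[g b]] /=; rewrite ?eact1 ?mul1g. Qed.

Lemma leaf_eactM g h e : leaf_eact (g * h) e = leaf_eact g (leaf_eact h e).
Proof. by case: e => [e|[k b]] /=; rewrite ?eactM ?mulgA. Qed.

Lemma leaf_act_src g (e : edge leaf_graph) : src (leaf_eact g e) = leaf_vact g (src e).
Proof. by case: e => [e|[k []]] //=; rewrite ?act_src ?vactM. Qed.

Lemma leaf_act_erev g (e : edge leaf_graph) : erev (leaf_eact g e) = leaf_eact g (erev e).
Proof. by case: e => [e|[k b]] //=; rewrite act_erev. Qed.

Definition leaf_action : graph_action G leaf_graph :=
  GraphAction leaf_vact1 leaf_vactM leaf_eact1 leaf_eactM leaf_act_src leaf_act_erev.

Let inV : vertex K -> vertex leaf_graph := @inl (vertex K) G.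
Let inE : edge K -> edge leaf_graph := @inl (edge K) (G * bool).

Definition leaf_retract (u : vertex leaf_graph) : vertex K :=
  match u with inl v => v | inr g => vact a g v0 end.

Lemma leaf_path x p y : edge_path (inV x) (map inE p) (inV y) <-> edge_path x p y.
Proof.
elim: p x => [|e p IH] x /=; first by split=> [[]|->].
by rewrite -IH; split=> -[]; [move=> [->]|move=> ->].
Qed.

Lemma leaf_leg u : within_distance 1 u (inV (leaf_retract u)).
Proof.
case: u => [v|g]; first by exists [::].
by exists [:: inr (g, false) : edge leaf_graph].
Qed.

Lemma leaf_within n u v : within_distance n (leaf_retract u) (leaf_retract v) ->
  within_distance (1 + n + 1) u v.
Proof.
move=> [p puv pn]; apply: (within_trans (within_trans (leaf_leg u) _)).
  by exists (map inE p); [apply/leaf_path/puv|rewrite size_map].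
exact/within_sym/leaf_leg.
Qed.

Lemma leaf_connected : connected_graph K -> connected_graph leaf_graph.
Proof.
move=> conn; split; first by exists (inV v0).
move=> u v; have [p puv] := conn.2 (leaf_retract u) (leaf_retract v).
by have [|q quv] := @leaf_within (size p) u v; [exists p|exists q].
Qed.

Lemma leaf_hyperbolic : connected_graph K ->
  (exists delta, hyperbolic_graph K delta) ->
  exists delta, hyperbolic_graph leaf_graph delta.
Proof.
move=> conn [delta hyp].
apply: (@hyperbolic_qi_embedding K delta conn hyp leaf_graph leaf_retract 2).
- exact: leaf_connected.
- move=> [e|[g b]].
    apply: dist_le; exists [:: e] => //=.
  rewrite (_ : leaf_retract (tgt _) = leaf_retract (src (inr (g, b) : edge leaf_graph))).
    by rewrite distxx.
  by case: b.
- move=> u v; apply: leq_trans (dist_le (leaf_within (within_dist conn _ _))) _.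
  lia.
Qed.

(** A circuit cannot turn around at a leaf. *)
Lemma circuit_no_leaf (c : seq (edge leaf_graph)) :
  circuit c -> forall g b, inr (g, b) \notin c.
Proof.
move=> [_ [x cx] _ nr] g b; apply/negP => ec.
have [d [dp dc _]] := closed_path_rot_edge cx ec.
have : inr (g, ~~ b) \notin c by apply: (nr _ ec).
rewrite -(perm_mem dc) seq.inE negb_or => /andP[_].
case: b {ec dc} dp => /=.
  case: d => [//|f d] /= [fg _]; rewrite seq.inE negb_or => /andP[/eqP[]].
  by case: f fg => [//|[h []]] //= [->].
case/lastP: d => [//|d f] /edge_path_rcons[_ fg].
rewrite mem_rcons seq.inE negb_or => /andP[/eqP[]].
by case: f fg => [//|[h []]] //= [->].
Qed.

Lemma leaf_fine : fine_graph K -> fine_graph leaf_graph.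
Proof.
move=> fineK n e.
have inlP (c : seq (edge leaf_graph)) : circuit c -> exists c', c = map inE c'.
  move=> /circuit_no_leaf; elim: c => [|[f|[g b]] c IH] nl; first by exists [::].
    have [g b|c' ->] := IH; last by exists (f :: c').
    by apply: contra (nl g b) => gc; rewrite seq.inE gc orbT.
  by have := nl g b; rewrite mem_head.
case: e => [e|[g b]]; last first.
  apply: (@finite_setS _ _ set0) => // c [/circuit_no_leaf/(_ g b) nl _ ec].
  by rewrite ec in nl.
apply: finite_setS (finite_image (map inE) (fineK n e)) _.
move=> c [cc cn ec]; have [c' cE] := inlP _ cc; exists c' => //.
have inEI : injective inE by move=> ? ? [].
have inVI : injective inV by move=> ? ? [].
rewrite {}cE in cc cn ec; case: cc => [c0 [x cx] uc nr].
rewrite size_map in cn; rewrite (mem_map inEI) in ec; split=> //; split.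
- by move=> c'0; rewrite c'0 in ec.
- case: c' cx ec {c0 uc nr cn} => // f c' cx _; exists (src f); apply/leaf_path.
  by case: (cx) => xE _; move: cx; rewrite -xE.
- move: uc; rewrite (_ : map _ (map _ c') = map inV (map (@src K) c')) ?(map_inj_uniq inVI) //.
  by rewrite -!map_comp; apply: eq_map.
- by move=> f; have := nr (inE f); rewrite !(mem_map inEI).
Qed.

Lemma leaf_edge_stabilizer : (forall e, finite_set (edge_stabilizer a e)) ->
  forall e, finite_set (edge_stabilizer leaf_action e).
Proof.
move=> fs [e|[g b]].
  by apply: finite_setS (fs e) _ => h [[he]|[he]]; [left|right].
apply: finite_setS (finite_set1 1) _ => h [[hg]|[_ bb]]; last by case: b bb.
by apply: (mulIg g); rewrite mul1g.
Qed.

Lemma leaf_edge_orbits : finite_set (range (edge_orbit a)) ->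
  finite_set (range (edge_orbit leaf_action)).
Proof.
move=> fo.
apply: (finite_setS (B := (fun O => inE @` O) @` range (edge_orbit a) `|`
    (edge_orbit leaf_action \o (fun b => inr (1, b))) @` [set: bool])).
  by rewrite finite_setU; split; apply: finite_image => //; apply: finite_finset.
move=> O [[e|[g b]] _ <-]; [left|right].
  exists (edge_orbit a e); first by exists e.
  apply/seteqP; split=> [_ [_ [h _ <-] <-]|_ [h _ <-]]; first by exists h.
  by exists (eact a h e) => //; exists h.
exists b => //; apply/seteqP; split=> _ [h _ <-] /=.
  by exists (h / g) => //=; rewrite mulgVK mulg1.
by exists (h * g) => //=; rewrite mulg1.
Qed.

Lemma leaf_stabilizers :
  infinite_vertex_stabilizers leaf_action = infinite_vertex_stabilizers a.
Proof.
have sE v : vertex_stabilizer leaf_action (inV v) = vertex_stabilizer a v.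
  by apply: subgroup_eqP; apply/seteqP; split=> g /=; [case|move=> ->].
apply/seteqP; split=> A [infA [v AE]]; split=> //; last by exists (inV v); rewrite sE.
case: v AE => [v|g] AE; first by exists v; rewrite -sE.
case: infA; rewrite AE; apply: finite_setS (finite_set1 1) _ => h /= [hg].
by apply: (mulIg g); rewrite mul1g.
Qed.

End LeafGraph.

Lemma relatively_hyperbolic_pointed (G : groupType) (PP : set (subgroup G)) :
  relatively_hyperbolic PP ->
  exists K (a : graph_action G K) o, pointed_action PP a o.
Proof.
move=> [_ [K [a [[conn hyp fineK] [fs fo reps]]]]].
have [v0 _] := conn.1.
exists (leaf_graph a v0), (leaf_action a v0), (inr 1); split.
- exact: leaf_connected.
- exact: leaf_hyperbolic.
- exact: leaf_fine.
- exact: leaf_edge_stabilizer.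
- exact: leaf_edge_orbits.
- by rewrite leaf_stabilizers.
- by move=> g [<-]; rewrite mulg1.
Qed.

(** * Orbit graphs are fine *)

Lemma finite_bound (T : Type) (A : set T) (P : T -> nat -> Prop) : finite_set A ->
  (forall x, A x -> exists n, P x n) ->
  (forall x m n, m <= n -> P x m -> P x n) -> exists n, forall x, A x -> P x n.
Proof.
move=> fA exP monoP.
have /choice[f hf] : forall x, exists n, A x -> P x n.
  move=> x; have [Ax|nAx] := pselect (A x); last by exists 0.
  by have [n Pn] := exP x Ax; exists n.
have /finite_seqP[s sE] := finite_image f fA.
exists (\max_(i <- s) i) => x Ax; apply: monoP (hf x Ax).
apply: (@leq_bigmax_seq _ s predT id) => //.
have : (f @` A) (f x) by exists x.
by rewrite sE.
Qed.

Lemma finite_bound_fun (T : Type) (A : set T) (f : T -> nat) : finite_set A ->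
  exists n, forall x, A x -> f x <= n.
Proof.
move=> fA; apply: finite_bound fA _ _ => [x _|x m n mn fm]; first by exists (f x).
exact: leq_trans mn.
Qed.

Lemma uniq_path_no_loop (K : graph) (x y : vertex K) p f : edge_path x p y ->
  uniq (path_vertices x p) -> f \in p -> src f <> tgt f.
Proof.
move=> pxy up fp; case/splitPr: fp pxy up => p1 p2 /edge_path_cat[z p1z [fz _]].
rewrite (path_vertices_cat _ p1z) cat_uniq /= negb_or => /and3P[_ /andP[+ _] _] ft.
by rewrite -ft fz (mem_path_end p1z).
Qed.

Section ActionPaths.
Variables (G : groupType) (K : graph) (a : graph_action G K).
Implicit Types (x y : vertex K) (e : edge K) (p : seq (edge K)) (g : G).

Lemma act_tgt g e : tgt (eact a g e) = vact a g (tgt e).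
Proof. by rewrite /tgt act_erev act_src. Qed.

Lemma vactK g x : vact a g^-1 (vact a g x) = x.
Proof. by rewrite -vactM mulVg vact1. Qed.

Lemma vactVK g x : vact a g (vact a g^-1 x) = x.
Proof. by rewrite -vactM mulgV vact1. Qed.

Lemma eactK g e : eact a g^-1 (eact a g e) = e.
Proof. by rewrite -eactM mulVg eact1. Qed.

Lemma eactVK g e : eact a g (eact a g^-1 e) = e.
Proof. by rewrite -eactM mulgV eact1. Qed.

Lemma vact_inj g : injective (vact a g).
Proof. exact: can_inj (vactK g). Qed.

Lemma eact_inj g : injective (eact a g).
Proof. exact: can_inj (eactK g). Qed.

Lemma edge_path_act g x p y : edge_path x p y ->
  edge_path (vact a g x) (map (eact a g) p) (vact a g y).
Proof.
elim: p x => [|e p IH] x /=; first by move=> ->.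
by move=> [ex /IH]; rewrite act_src ex -act_tgt.
Qed.

Lemma path_vertices_act g x p :
  path_vertices (vact a g x) (map (eact a g) p) = map (vact a g) (path_vertices x p).
Proof.
by rewrite /path_vertices /= -!map_comp; congr cons; apply: eq_map => e /=; rewrite act_tgt.
Qed.

Lemma within_act g n x y :
  within_distance n x y -> within_distance n (vact a g x) (vact a g y).
Proof.
by move=> [p pxy pn]; exists (map (eact a g) p); [apply: edge_path_act|rewrite size_map].
Qed.

Lemma dist_act g x y : connected_graph K -> dist (vact a g x) (vact a g y) = dist x y.
Proof.
move=> conn; apply/eqP; rewrite eqn_leq.
rewrite (dist_le (within_act g (within_dist conn x y))) /=.
apply/dist_le; rewrite -{2}(vactK g x) -{2}(vactK g y).
exact/within_act/within_dist.
Qed.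

Lemma geodesic_act g x p y : connected_graph K -> geodesic x p y ->
  geodesic (vact a g x) (map (eact a g) p) (vact a g y).
Proof.
move=> conn /(geodesicP conn)[pxy sp]; apply/(geodesicP conn).
by rewrite size_map dist_act //; split=> //; apply: edge_path_act.
Qed.

(** This set is empty or a coset of the stabilizer of [e]. *)
Lemma finite_edge_transporter e f : finite_set (edge_stabilizer a e) ->
  finite_set [set g | eact a g e = f].
Proof.
move=> fe; have [[g0 g0e]|ne] := pselect (exists g, eact a g e = f); last first.
  by apply: (finite_setS (@finite_set0 _)) => g ge; case: ne; exists g.
apply: finite_setS (finite_image ( *%g g0) fe) _ => g /= ge.
by exists (g0^-1 * g); [left; rewrite eactM ge -g0e eactK|rewrite mulVKg].
Qed.

End ActionPaths.

Section OrbitGraph.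
Variables (G : groupType) (K : graph) (a : graph_action G K) (o : vertex K).
Variable T : set (vertex K).
Hypothesis free_o : forall g, vact a g o = o -> g = 1.

Definition orbit_edges : set (G * vertex K * bool) := [set e | T e.1.2].

Definition orbit_src (e : orbit_edges) : vertex K :=
  vact a (val e).1.1 (if (val e).2 then (val e).1.2 else o).

Lemma orbit_rev_subproof (e : orbit_edges) :
  ((val e).1, ~~ (val e).2) \in orbit_edges.
Proof. by apply/mem_set; have /set_mem := valP e. Qed.

Definition orbit_rev (e : orbit_edges) : orbit_edges :=
  exist (fun u => u \in orbit_edges) _ (orbit_rev_subproof e).

Lemma orbit_revK : involutive orbit_rev.
Proof. by move=> e; apply: val_inj => /=; rewrite negbK; case: (val e). Qed.

Lemma orbit_rev_neq e : orbit_rev e != e.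
Proof. by apply/eqP => /(congr1 (fun u : orbit_edges => (val u).2)) /=; case: (val e).2. Qed.

(** An edge from [g o] to [g t] for each [g] in [G] and [t] in [T]. Labelling edges by
[g] makes the action on them free. *)
Definition orbit_graph : graph :=
  @Graph (vertex K) orbit_edges orbit_src orbit_rev orbit_revK orbit_rev_neq.

Lemma orbit_eact_subproof (h : G) (e : orbit_edges) :
  ((h * (val e).1.1, (val e).1.2), (val e).2) \in orbit_edges.
Proof. by apply/mem_set; have /set_mem := valP e. Qed.

Definition orbit_eact (h : G) (e : edge orbit_graph) : edge orbit_graph :=
  exist (fun u => u \in orbit_edges) _ (orbit_eact_subproof h e).

Lemma orbit_eact1 e : orbit_eact 1 e = e.
Proof. by apply: val_inj; rewrite /= mul1g; case: (val e) => -[]. Qed.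

Lemma orbit_eactM g h e : orbit_eact (g * h) e = orbit_eact g (orbit_eact h e).
Proof. by apply: val_inj; rewrite /= mulgA. Qed.

Lemma orbit_act_src g (e : edge orbit_graph) : src (orbit_eact g e) = vact a g (src e).
Proof. by rewrite /= /orbit_src /= vactM. Qed.

Lemma orbit_act_erev g (e : edge orbit_graph) : erev (orbit_eact g e) = orbit_eact g (erev e).
Proof. exact: val_inj. Qed.

Definition orbit_action : graph_action G orbit_graph :=
  @GraphAction G orbit_graph (vact a) orbit_eact (vact1 a) (vactM a) orbit_eact1
    orbit_eactM orbit_act_src orbit_act_erev.

Lemma orbit_tgt (e : edge orbit_graph) :
  tgt e = vact a (val e).1.1 (if (val e).2 then o else (val e).1.2).
Proof. by rewrite /tgt /= /orbit_src /=; case: (val e).2. Qed.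

Definition orbit_mk (g : G) (t : vertex K) (b : bool) (Tt : T t) : edge orbit_graph :=
  exist (fun u => u \in orbit_edges) (g, t, b) (mem_set (Tt : orbit_edges (g, t, b))).

Lemma orbit_srcE (e : edge orbit_graph) :
  src e = vact a (val e).1.1 (if (val e).2 then (val e).1.2 else o).
Proof. by []. Qed.

Lemma orbit_mk_src g t b (Tt : T t) :
  @src orbit_graph (orbit_mk g b Tt) = vact a g (if b then t else o).
Proof. by []. Qed.

Lemma orbit_mk_tgt g t b (Tt : T t) :
  @tgt orbit_graph (orbit_mk g b Tt) = vact a g (if b then o else t).
Proof. exact: orbit_tgt. Qed.

Lemma free_inj g h : vact a g o = vact a h o -> g = h.
Proof.
move=> gh; have /free_o : vact a (h^-1 * g) o = o by rewrite vactM gh vactK.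
by move/mulg1_eq; rewrite invgK.
Qed.

Lemma finite_orbit_edges (B : set (G * vertex K * bool)) (A : set (edge orbit_graph)) :
  finite_set B -> (forall e, A e -> B (val e)) -> finite_set A.
Proof.
move=> fB AB; apply: (@finite_setS _ _ (val @^-1` B)); last exact: AB.
by apply: finite_preimage => // e e' _ _; apply: val_inj.
Qed.

Hypothesis conn : connected_graph K.
Hypothesis finT : finite_set T.
Hypothesis finS : forall e : edge K, finite_set (edge_stabilizer a e).
Hypothesis angK : angle_finite K.

Let pi_ (t : vertex K) : seq (edge K) := sval (cid (geodesic_ex conn o t)).

Let pi_geo t : geodesic o (pi_ t) t.
Proof. by rewrite /pi_; case: cid. Qed.

Let tile t : set (edge K) := [set f | f \in pi_ t \/ erev f \in pi_ t].

Let finite_tile t : finite_set (tile t).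
Proof.
apply: (finite_setS (B := [set` pi_ t] `|` (@erev K) @` [set` pi_ t])).
  by rewrite finite_setU; split; [|apply: finite_image]; apply: finite_seq.
move=> f [fp|fp]; [by left|right]; exists (erev f) => //; exact: erevK.
Qed.

(** An edge of the orbit graph is replaced by the translate of a geodesic of [K] chosen
once for all [g]; so, up to translation, only finitely many edges of [K] occur. *)
Lemma orbit_edge_realized m : (forall t, T t -> size (pi_ t) <= m) ->
  forall e : edge orbit_graph, exists g t (r : seq (edge K)),
  [/\ T t, @edge_path K (src e) r (tgt e), size r <= m, forall f, f \in r -> exists2 f0, tile t f0 & f = eact a g f0 &
    forall f, f \in r -> src f <> tgt f].
Proof.
move=> hm e; rewrite orbit_tgt; case: e => [[[g t] b] eT]; rewrite /= /orbit_src /=.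
have Tt : T t := set_mem eT; move=> {eT}; exists g, t.
have geo := geodesic_act a g conn (pi_geo t).
case: b => /=.
  have rgeo := geodesic_rev geo.
  exists (rev_path (map (eact a g) (pi_ t))); split=> //; first exact: rgeo.1.
  - by rewrite size_rev_path size_map hm.
  - move=> f; rewrite mem_rev_path => /mapP[f0 f0p fE]; exists (erev f0).
      by right; rewrite erevK.
    by rewrite -act_erev -fE erevK.
  - move=> f; exact: uniq_path_no_loop rgeo.1 (geodesic_uniq rgeo).
exists (map (eact a g) (pi_ t)); split=> //; first exact: geo.1.
- by rewrite size_map hm.
- by move=> f /mapP[f0 f0p fE]; exists f0 => //; left.
- move=> f; exact: uniq_path_no_loop geo.1 (geodesic_uniq geo).
Qed.

(** The last edge by which the realization of an orbit edge into [v] leaves [v]. *)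
Lemma orbit_exit_edge m g t v : (forall t, T t -> size (pi_ t) <= m) -> T t ->
  vact a g t = v -> v <> vact a g o ->
  exists f p, [/\ tile t f, src (eact a g f) = v,
    edge_path (tgt (eact a g f)) p (vact a g o), size p <= m &
    v \notin path_vertices (tgt (eact a g f)) p].
Proof.
move=> hm Tt gt vo; have geo := geodesic_rev (geodesic_act a g conn (pi_geo t)).
have := geodesic_uniq geo; have := geo.1; rewrite gt.
have := size_rev_path (map (eact a g) (pi_ t)); rewrite size_map.
case E : (rev_path _) => [|f p] sp /=; first by move/vo.
move=> [fv fp] /andP[vp _].
have : f \in rev_path (map (eact a g) (pi_ t)) by rewrite E mem_head.
rewrite mem_rev_path => /mapP[f0 f0p fE].
have fE' : f = eact a g (erev f0) by rewrite -act_erev -fE erevK.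
exists (erev f0), p; rewrite -fE'; split=> //; first by right; rewrite erevK.
by apply: leq_trans (hm _ Tt); rewrite -sp.
Qed.

Section AtVertex.
Local Open Scope nat_scope.
Variables (v : vertex K) (N : nat).

(** How the edges by which a realized path arrives at [v] and later leaves [v] are
related. Branching is finite: for small angles by fineness of [K], for pairs of edges
of a translated geodesic by finiteness of edge stabilizers. *)
Let linked (e e' : edge K) : Prop :=
  [\/ e = e', angle v N e e' | exists g t f f',
      [/\ T t, tile t f, tile t f', e = eact a g f & e' = eact a g f']].

Let finite_linked e : finite_set [set e' | linked e e'].
Proof.
apply: (finite_setS (B := [set e] `|` [set e' | angle v N e e'] `|`
   \bigcup_(t in T) \bigcup_(f in tile t) \bigcup_(f' in tile t)
     (fun g => eact a g f') @` [set g | eact a g f = e])).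
  rewrite !finite_setU; split; first by split; [exact: finite_set1|exact: angK].
  apply: bigcup_finite => // t _; apply: bigcup_finite => // f _.
  apply: bigcup_finite => // f' _; apply: finite_image.
  exact: finite_edge_transporter.
move=> e' [->|ang|[g [t [f [f' [Tt tf tf' ef e'f]]]]]]; [by left; left|by left; right|right].
by exists t => //; exists f => //; exists f' => //; exists g.
Qed.

Let Fixpoint chain (k : nat) (e e' : edge K) : Prop :=
  if k is k.+1 then exists2 e1, chain k e e1 & linked e1 e' else e = e'.

Let finite_chain k e : finite_set [set e' | chain k e e'].
Proof.
elim: k => [|k IH]; first by apply: finite_setS (finite_set1 e) _ => e' /= ->.
apply: (finite_bigcup_sub IH (fun e1 _ => finite_linked e1)).
by move=> e' /= [e1 h1 h2]; exists e1.
Qed.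

Let chain_mono k k' e e' : k <= k' -> chain k e e' -> chain k' e e'.
Proof.
move=> kk; rewrite -(subnKC kk); elim: (k' - k)%N => [|d IH] h; rewrite ?addn0 // addnS /=.
by exists e'; [apply: IH|constructor 1].
Qed.

(** The invariant carried along a path of the orbit graph that starts next to [e0]
and avoids [v], while its edges are replaced by paths of [K], which may visit [v]. *)
Let seen e0 k l (x : vertex K) : Prop := exists e p,
  [/\ chain k e0 e, src e = v, edge_path (tgt e) p x, size p <= l &
      v \notin path_vertices (tgt e) p].

Let seen_mono e0 k k' l l' x : k <= k' -> l <= l' -> seen e0 k l x -> seen e0 k' l' x.
Proof.
move=> kk ll [e [p [h1 h2 h3 h4 h5]]]; exists e, p; split=> //.
  exact: chain_mono h1.
exact: leq_trans ll.
Qed.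

(** Off [v] the current path is prolonged. A visit of [v] adds two links: the angle up
to the edge of arrival, then the passage to the edge of departure, which belongs to
the same translated geodesic. *)
Let seen_realized e0 g t r x y k l : T t -> edge_path x r y -> y <> v ->
  (forall f, f \in r -> exists2 f0, tile t f0 & f = eact a g f0) ->
  (forall f, f \in r -> src f <> tgt f) ->
  seen e0 k l x -> l + size r <= N -> seen e0 (k + 2 * size r) (l + size r) y.
Proof.
move=> Tt + yv; have [n] := ubnP (size r); elim: n r x k l => // n IH r x k l.
case: r => [|f r] rn; first by move=> /= <- _ _ s _; apply: seen_mono s; lia.
move=> /= [fx rP] til nl [e [p [ch ev ep pl vp]]] lN.
have [fv|/eqP fv] := eqVneq (tgt f) v; last first.
  apply: (@seen_mono _ (k + 2 * size r) _ (l.+1 + size r)); [lia|lia|].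
  apply: IH rP _ _ _ _ => //; [by move=> f' f'r; apply: til; rewrite seq.inE f'r orbT|
    by move=> f' f'r; apply: nl; rewrite seq.inE f'r orbT| |lia].
  exists e, (rcons p f); split=> //.
  - by rewrite edge_path_rcons fx.
  - by rewrite size_rcons.
  - rewrite -cats1 (path_vertices_cat _ ep) mem_cat negb_or vp /= seq.inE.
    by apply/eqP => /esym.
case: r => [|f' r] in rn rP til nl lN *; first by move: rP => /=; rewrite fv => /esym.
move: rP => /= [f'v rP]; rewrite fv in f'v.
have [f0 tf0 fE] := til f (mem_head _ _).
have [f0' tf0' fE'] : exists2 f0, tile t f0 & f' = eact a g f0.
  by apply: til; rewrite !seq.inE eqxx orbT.
have f'l : src f' <> tgt f' by apply: nl; rewrite !seq.inE eqxx orbT.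
apply: (@seen_mono _ (k.+2 + 2 * size r) _ (0 + size r)); [by move=> /=; lia|by move=> /=; lia|].
apply: IH rP _ _ _ _ => //; [by move: rn => /=; lia|
    by move=> h hr; apply: til; rewrite !seq.inE hr !orbT|
    by move=> h hr; apply: nl; rewrite !seq.inE hr !orbT| |by move: lN => /=; lia].
exists f', [::]; split=> //=; last by rewrite seq.inE -f'v; apply/eqP.
exists (erev f); last first.
  constructor 3; exists g, t, (erev f0), f0'; split=> //; last by rewrite fE act_erev.
  by case: tf0 => h; [right; rewrite erevK|left].
exists e => //; constructor 2; split=> //; exists p; split; rewrite ?tgt_erev ?fx //.
by move: lN; lia.
Qed.

Let seen_path e0 m q x y k l : (forall t, T t -> size (pi_ t) <= m) ->
  @edge_path orbit_graph x q y -> v \notin @path_vertices orbit_graph x q ->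
  seen e0 k l x -> l + m * size q <= N ->
  seen e0 (k + 2 * (m * size q)) (l + m * size q) y.
Proof.
move=> hm; elim: q x k l => [|e q IH] x k l /=; first by move=> <- _ s _; apply: seen_mono s; lia.
move=> [ex qy]; rewrite seq.inE negb_or => /andP[vx vq] sx lN.
have [g [t [r [Tt rP rm til nl]]]] := orbit_edge_realized hm e.
apply: (@seen_mono _ (k + 2 * m + 2 * (m * size q)) _ (l + m + m * size q)).
- by rewrite mulnS mulnDr addnA.
- by rewrite mulnS addnA.
apply: (IH (tgt e)) => //; last by move: lN; rewrite mulnS addnA.
apply: (@seen_mono _ (k + 2 * size r) _ (l + size r)); [lia|lia|].
apply: (@seen_realized e0 g t r x) => //; [by rewrite -ex| |by move: lN; rewrite mulnS; lia].
by move: vq => /=; rewrite seq.inE negb_or => /andP[/eqP tv _] /esym.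
Qed.

(** The realizations of both edges leave [v] by edges that are connected by boundedly
many links, and an orbit edge whose realization contains a given edge is one of
finitely many. *)
Lemma orbit_angle_finite_at m n e : (forall t, T t -> size (pi_ t) <= m) ->
  (forall g, v <> vact a g o) -> N = m + m * n + m ->
  finite_set [set e' | @angle orbit_graph v n e e'].
Proof.
move=> hm vo NE.
have edgeE (e1 : edge orbit_graph) : src e1 = v ->
    exists g t, [/\ T t, val e1 = (g, t, true) & vact a g t = v].
  case: e1 => [[[g t] b] eT]; rewrite /= /orbit_src /=.
  have Tt : T t := set_mem eT; case: b {eT} => // ev; first by exists g, t.
  by case: (vo g).
have [ev|nev] := pselect (src e = v); last first.
  by apply: (finite_setS (@finite_set0 _)) => e' [/nev].
have [g0 [t0 [Tt0 eE gt0]]] := edgeE e ev.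
have [f0 [p0 [tf0 f0v p0P p0m vp0]]] := orbit_exit_edge hm Tt0 gt0 (vo g0).
pose e0 := eact a g0 f0.
have fE : finite_set (\bigcup_(e1 in [set e1 | chain (2 * (m * n)).+1 e0 e1])
    \bigcup_(t in T) \bigcup_(f in tile t) (fun g => (g, t, true)) @` [set g | eact a g f = e1]).
  apply: bigcup_finite => // e1 _; apply: bigcup_finite => // t _.
  by apply: bigcup_finite => // f _; apply/finite_image/finite_edge_transporter.
apply: finite_orbit_edges fE _ => e' [_ e'v [q [qe qn vq]]].
have [g1 [t1 [Tt1 e'E gt1]]] := edgeE e' e'v.
have [f1 [p1 [tf1 f1v p1P p1m vp1]]] := orbit_exit_edge hm Tt1 gt1 (vo g1).
exists (eact a g1 f1); last first.
  by exists t1 => //; exists f1 => //; exists g1.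
have teo : tgt e = vact a g0 o by rewrite orbit_tgt eE.
have te'o : tgt e' = vact a g1 o by rewrite orbit_tgt e'E.
have s0 : seen e0 0 m (tgt e) by exists e0, p0; rewrite teo; split.
have mqn : m * size q <= m * n by rewrite leq_mul2l qn orbT.
have [|e1 [p [ch e1v p1P' pl vp]]] := seen_path hm qe vq s0; first by lia.
exists e1; first by apply: chain_mono ch; lia.
constructor 2; split=> //; exists (p ++ rev_path p1).
rewrite te'o in p1P'; split.
- exact: edge_path_catI p1P' (edge_path_rev p1P).
- by rewrite size_cat size_rev_path; lia.
- by rewrite (mem_path_vertices_cat _ _ p1P') negb_or vp (mem_path_rev _ p1P).
Qed.

End AtVertex.

(** A vertex of the orbit of [o] has only finitely many edges; at the other vertices
angles are finite by comparison with [K]. *)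
Lemma orbit_graph_fine : fine_graph orbit_graph.
Proof.
apply: angle_finite_fine => v n e.
have [m hm] : exists m, forall t, T t -> size (pi_ t) <= m.
  exact: finite_bound_fun finT.
have [[g vg]|nvo] := pselect (exists g, v = vact a g o); last first.
  apply: (orbit_angle_finite_at (N := (m + m * n + m)%N) _ hm) => // g vg.
  by apply: nvo; exists g.
have fB : finite_set ((fun t => (g, t, false)) @` T `|`
    \bigcup_(t in T) (fun g' => (g', t, true)) @` [set g' | vact a g' t = vact a g o]).
  rewrite finite_setU; split; first exact: finite_image.
  apply: bigcup_finite => // t _; apply: finite_image.
  have [[h ht]|nt] := pselect (exists h, t = vact a h o); last first.
    apply: (finite_setS (@finite_set0 _)) => g' g't; case: nt; exists (g'^-1 * g).
    by rewrite vactM -g't vactK.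
  apply: finite_setS (finite_set1 (g / h)) _ => g' /=; rewrite ht -vactM => /free_inj <-.
  by rewrite mulgK.
apply: finite_orbit_edges fB _ => e' [_ + _].
case: e' => [[[g' t] b] eT]; rewrite /= /orbit_src /=.
have Tt : T t := set_mem eT; case: b {eT} => //; rewrite vg => e'v.
  by right; exists t => //; exists g'.
by left; exists t => //; rewrite (free_inj e'v).
Qed.

End OrbitGraph.

(** * Relative Cayley graphs *)

Section CayleyAction.
Variables (G : groupType) (A : set G).

Lemma cayley_eact_subproof (h : G) (e : cayley_adjacent A) :
  (h * (val e).1, h * (val e).2) \in cayley_adjacent A.
Proof.
have /set_mem[e12 eA] := valP e; apply/mem_set; split=> /=; first by move/mulgI.
by rewrite !invgM -!mulgA !mulKg.
Qed.

Definition cayley_eact (h : G) (e : edge (cayley_graph A)) : edge (cayley_graph A) :=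
  exist (fun u => u \in cayley_adjacent A) _ (cayley_eact_subproof h e).

Definition cayley_vact (h : G) (x : vertex (cayley_graph A)) : vertex (cayley_graph A) :=
  (h : G) * x.

Lemma cayley_vact1 x : cayley_vact 1 x = x. Proof. exact: mul1g. Qed.

Lemma cayley_vactM g h x : cayley_vact (g * h) x = cayley_vact g (cayley_vact h x).
Proof. by rewrite /cayley_vact mulgA. Qed.

Lemma cayley_eact1 e : cayley_eact 1 e = e.
Proof. by apply: val_inj; rewrite /= !mul1g; case: (val e). Qed.

Lemma cayley_eactM g h e : cayley_eact (g * h) e = cayley_eact g (cayley_eact h e).
Proof. by apply: val_inj; rewrite /= !mulgA. Qed.

Lemma cayley_act_src g (e : edge (cayley_graph A)) :
  src (cayley_eact g e) = cayley_vact g (src e).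
Proof. by []. Qed.

Lemma cayley_act_erev g (e : edge (cayley_graph A)) :
  erev (cayley_eact g e) = cayley_eact g (erev e).
Proof. exact: val_inj. Qed.

Definition cayley_action : graph_action G (cayley_graph A) :=
  GraphAction cayley_vact1 cayley_vactM cayley_eact1 cayley_eactM cayley_act_src
    cayley_act_erev.

Definition cayley_within n (x y : G) : Prop := @within_distance (cayley_graph A) n x y.
Definition cayley_dist (x y : G) : nat := @dist (cayley_graph A) x y.

Lemma cayley_within_mul h n x y : cayley_within n x y -> cayley_within n (h * x) (h * y).
Proof. exact: (@within_act _ _ cayley_action h n x y). Qed.

Lemma cayley_dist_mul h x y : connected_graph (cayley_graph A) ->
  cayley_dist (h * x) (h * y) = cayley_dist x y.
Proof. exact: (@dist_act _ _ cayley_action h x y). Qed.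

Lemma cayley_within_gen x y : A (x^-1 * y) -> cayley_within 1 x y.
Proof.
move=> Axy; have [->|/eqP xy] := eqVneq x y; first by exists [::].
have e : (x, y) \in cayley_adjacent A by apply/mem_set; split=> //; left.
by exists [:: exist (fun u => u \in cayley_adjacent A) (x, y) e : edge (cayley_graph A)].
Qed.

Lemma cayley_edgeP (e : edge (cayley_graph A)) :
  A ((src e : G)^-1 * tgt e) \/ A ((tgt e : G)^-1 * src e).
Proof. by have /set_mem[_] := valP e. Qed.

Lemma cayley_connected : generates A -> connected_graph (cayley_graph A).
Proof.
move=> genA; pose B : set G := [set g | exists n, cayley_within n 1 g].
have BG : group_closed (fun x : G => x \in B).
  apply: group_closed_set; first by exists 0%N; apply: within_refl.
  move=> x y [m xm] [n yn]; exists (n + m)%N.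
  have y1 : cayley_within n 1 y^-1.
    have := cayley_within_mul y^-1 yn; rewrite mulg1 mulVg; exact: within_sym.
  rewrite addnC; apply: (within_trans xm).
  by have := cayley_within_mul x y1; rewrite mulg1.
have /(_ (Subgroup BG)) := genA; have AB : A `<=` Subgroup BG.
  move=> x Ax; exists 1%N; apply: cayley_within_gen.
  by rewrite invg1 mul1g.
move=> /(_ AB) /= BT; split; first by exists (1 : G).
move=> x y; have [n] : B ((x : G)^-1 * y) by rewrite BT.
move=> /(cayley_within_mul x); rewrite mulg1 mulVKg => -[p pxy _]; by exists p.
Qed.

End CayleyAction.

Definition relative_cayley (G : groupType) (PP : set (subgroup G)) (S : set G) : graph :=
  cayley_graph (S `|` peripheral_elements PP).

Lemma relative_cayley_connected (G : groupType) (PP : set (subgroup G)) (S : set G) :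
  relative_generating_set PP S -> connected_graph (relative_cayley PP S).
Proof.
move=> [_ gen]; apply: cayley_connected => B AB; apply: gen => x [Sx|[P PPP Px]].
  by apply: AB; left.
have [->|/eqP x1] := eqVneq x 1; last by apply: AB; right; split=> //; exists P.
by have [B1 _] := subgroup_closed B; apply/set_mem.
Qed.

Section Subgroups.
Variables (G : groupType).
Implicit Types (B H : subgroup G) (x y : G).

Lemma subgroup1 B : (B : set G) 1.
Proof. by have [B1 _] := subgroup_closed B; apply/set_mem. Qed.

Lemma subgroupF B x y : (B : set G) x -> (B : set G) y -> (B : set G) (x / y).
Proof.
move=> Bx By; have [_ BF] := subgroup_closed B.
by apply/set_mem/BF; apply/mem_set.
Qed.

Lemma subgroupV B x : (B : set G) x -> (B : set G) x^-1.
Proof. by move=> /(subgroupF (subgroup1 B)); rewrite div1g. Qed.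

Lemma subgroupM B x y : (B : set G) x -> (B : set G) y -> (B : set G) (x * y).
Proof. by move=> Bx /subgroupV /(subgroupF Bx); rewrite invgK. Qed.

End Subgroups.

Lemma edge_orbit_representatives (G : groupType) (K : graph) (a : graph_action G K) :
  finite_set (range (edge_orbit a)) ->
  exists F : set (edge K), finite_set F /\ forall e, exists g f, F f /\ e = eact a g f.
Proof.
move=> fo.
have /choice[r hr] : forall O : set (edge K), exists x : option (edge K),
    O !=set0 -> exists2 e, x = Some e & O e.
  move=> O; have [[e Oe]|nO] := pselect (O !=set0); last by exists None.
  by exists (Some e) => _; exists e.
exists [set f | (r @` range (edge_orbit a)) (Some f)]; split.
  apply: finite_preimage (finite_image r fo).
  by move=> x y _ _ [].
move=> e; have [|f rf [g _ gf]] := hr (edge_orbit a e).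
  by exists e; exists 1 => //; apply: eact1.
exists g^-1, f; split; last by rewrite -gf eactK.
by exists (edge_orbit a e) => //; exists e.
Qed.

(** [o] is a default value, for subgroups [P] that are not vertex stabilizers. *)
Definition cone_point (G : groupType) (K : graph) (a : graph_action G K) (o : vertex K)
    (P : subgroup G) : vertex K :=
  if pselect (exists v, vertex_stabilizer a v = P) is left ex then projT1 (cid ex) else o.

Section PointedAction.
Variables (G : groupType) (PP : set (subgroup G)) (K : graph) (a : graph_action G K).
Variables (o : vertex K).
Hypotheses (finPP : finite_set PP) (pa : pointed_action PP a o).

Let conn := pa_connected pa.
Let tri := dist_triangle conn.
Let cone := cone_point a o.

Lemma stabilizer_cone P : PP P -> vertex_stabilizer a (cone P) = P.
Proof.
move=> /(pa_representatives pa).1[_ [v Pv]]; rewrite /cone /cone_point.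
case: pselect => [ex|[]]; last by exists v; apply: subgroup_eqP.
by case: cid.
Qed.

Lemma cone_fixed P g : PP P -> (P : set G) g <-> vact a g (cone P) = cone P.
Proof. by move=> /stabilizer_cone {1}<-. Qed.

Lemma cone_not_orbit P g h : PP P -> vact a g (cone P) <> vact a h o.
Proof.
move=> PPP gh; have [infP _] := (pa_representatives pa).1 _ PPP.
apply: infP; apply: finite_setS (finite_set1 1) _ => k /(cone_fixed _ PPP) kP.
have ho : cone P = vact a (g^-1 * h) o by rewrite vactM -gh vactK.
rewrite ho -vactM in kP; apply: (mulIg (g^-1 * h)).
by rewrite mul1g; exact: (free_inj (pa_free pa) kP).
Qed.

(** The two cone points have conjugate stabilizers, and distinct members of [PP] are
not conjugate. *)
Lemma cone_eq P P' g h : PP P -> PP P' -> vact a g (cone P) = vact a h (cone P') ->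
  P = P' /\ (P : set G) (g^-1 * h).
Proof.
move=> PPP PPP' gh; have [sub uni] := pa_representatives pa.
suff PP' : P = P'.
  split=> //; apply/(cone_fixed _ PPP).
  by rewrite vactM [in LHS]PP' -gh vactK.
have [B [_ Buni]] := uni _ (sub _ PPP).
have <- : B = P.
  apply: Buni; split=> //; exists 1; apply/seteqP.
  by split=> x /=; rewrite conjg1.
apply: Buni; split=> //.
have cE : cone P = vact a (g^-1 * h) (cone P') by rewrite vactM -gh vactK.
exists (g^-1 * h); apply/seteqP; split=> x /=.
  move=> /(cone_fixed _ PPP) xP; apply/(cone_fixed _ PPP').
  by rewrite conjgE vactM [vact a (x * _) _]vactM -cE xP cE vactK.
move=> /(cone_fixed _ PPP') xP'; apply/(cone_fixed _ PPP); rewrite cE -{2}xP'.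
by rewrite conjgE -!vactM; congr vact; rewrite mulVKg.
Qed.

(** * The Cayley graph and the (G, PP)-graph *)

Section Comparison.
Variable S : set G.
Hypotheses (finS : finite_set S) (genS : relative_generating_set PP S).

Let connS := relative_cayley_connected genS.
Local Notation cdist := (cayley_dist (S `|` peripheral_elements PP)).
Let ctri (y x z : G) : cdist x z <= cdist x y + cdist y z := dist_triangle connS y x z.

(** A peripheral edge from [x] to [x p], with [p] in [P], is short in [K] because both
orbit points are as far from [x (cone P)] as [o] is from [cone P]. *)
Lemma relative_cayley_lipschitz : exists C,
  forall e : edge (relative_cayley PP S), dist (vact a (src e) o) (vact a (tgt e) o) <= C.
Proof.
have [C1 h1] := finite_bound_fun (fun s => dist o (vact a s o)) finS.
have [C2 h2] := finite_bound_fun (fun P => dist o (cone P)) finPP.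
have tr x y : dist (vact a x o) (vact a y o) = dist o (vact a (x^-1 * y) o).
  by rewrite -(dist_act a x o) // -vactM mulVKg.
have half x y : (S `|` peripheral_elements PP) (x^-1 * y) ->
    dist (vact a x o) (vact a y o) <= C1 + C2 + C2.
  rewrite tr => -[/h1|[_ [P PPP Pxy]]]; first lia.
  have := tri (cone P) o (vact a (x^-1 * y) o); have := h2 P PPP.
  have -> : dist (cone P) (vact a (x^-1 * y) o) = dist o (cone P).
    by rewrite -{1}((cone_fixed _ PPP).1 Pxy) dist_act // dist_sym.
  lia.
exists (C1 + C2 + C2)%N => e; have [/half//|/half] := cayley_edgeP e.
by rewrite dist_sym.
Qed.

(** An infinite stabilizer is conjugate to a member of [PP], and the elements of the
latter are at distance at most 1 from [1]. *)
Lemma cayley_stabilizer_bound x : exists C,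
  forall g, vact a g x = x -> cdist 1 g <= C.
Proof.
have [fx|infx] := pselect (finite_set (vertex_stabilizer a x : set G)).
  exact: (finite_bound_fun (fun g => cdist 1 g) fx).
have Fx : infinite_vertex_stabilizers a (vertex_stabilizer a x) by split=> //; exists x.
have [P [[PPP [w wE]] _]] := (pa_representatives pa).2 _ Fx.
exists (cdist 1 w + 1 + cdist 1 w^-1)%N => g gx.
have Pg : (P : set G) (g ^ w).
  by have : (vertex_stabilizer a x : set G) g := gx; rewrite wE.
have d1 : cdist w (w * g ^ w) <= 1.
  have [->|/eqP g1] := eqVneq (g ^ w) 1; first by rewrite mulg1 [cdist _ _]distxx.
  apply/dist_le/cayley_within_gen; rewrite mulKg.
  by right; split=> //; exists P.
have -> : cdist 1 g = cdist 1 (w * g ^ w / w) by rewrite conjgE mulVKg mulgK.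
have d2 : cdist (w * g ^ w) (w * g ^ w / w) = cdist 1 w^-1.
  by rewrite -{1}(mulg1 (w * g ^ w)) cayley_dist_mul.
have := ctri w 1 (w * g ^ w / w); have := ctri (w * g ^ w) w (w * g ^ w / w).
move: d1 d2; lia.
Qed.

(** Nearby orbit points come from nearby group elements: a path in [K] is covered
by translates of finitely many edges, and two translates of a vertex differ by a
coset of its stabilizer, which has bounded diameter in the Cayley graph. *)
Lemma relative_cayley_dist_le : exists C, forall g h,
  cdist g h <= (C * dist (vact a g o) (vact a h o) + C)%N.
Proof.
have [F [finF FE]] := edge_orbit_representatives (pa_edge_orbits pa).
pose U : set (vertex K) := [set o] `|` ((@src K) @` F `|` (@tgt K) @` F).
have finU : finite_set U.
  by rewrite !finite_setU; split; [exact: finite_set1|split; exact: finite_image].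
have [C hC] : exists C, forall xy, (U `*` U) xy ->
    forall k, vact a k xy.1 = xy.2 -> cdist 1 k <= C.
  apply: (finite_bound (P := fun xy C => forall k, vact a k xy.1 = xy.2 -> cdist 1 k <= C)).
  - exact: finite_setX.
  - move=> [x y] _ /=.
    have [[k0 k0x]|nk] := pselect (exists k, vact a k x = y); last first.
      by exists 0%N => k kx; case: nk; exists k.
    have [C hC] := cayley_stabilizer_bound x; exists (cdist 1 k0 + C)%N => k kx.
    have -> : cdist 1 k = cdist 1 (k0 * (k0^-1 * k)) by rewrite mulVKg.
    have /hC d : vact a (k0^-1 * k) x = x by rewrite vactM kx -k0x vactK.
    have d2 : cdist k0 (k0 * (k0^-1 * k)) = cdist 1 (k0^-1 * k).
      by rewrite -{1}(mulg1 k0) cayley_dist_mul.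
    have := ctri k0 1 (k0 * (k0^-1 * k)); move: d d2; lia.
  - by move=> xy m n mn h k /h; move/leq_trans; apply.
have claim u g h : U (vact a g^-1 u) -> U (vact a h^-1 u) -> cdist g h <= C.
  move=> Ug Uh; rewrite -(cayley_dist_mul g^-1 g h connS) mulVg.
  have -> : cdist 1 (g^-1 * h) = cdist (g^-1 * h) 1 by apply: dist_sym.
  rewrite -(cayley_dist_mul (h^-1 * g) _ _ connS) mulg1 mulgA -(mulgA h^-1) mulgV mulg1 mulVg.
  by apply: (hC (vact a g^-1 u, vact a h^-1 u)) => //=; rewrite vactM vactVK.
have cover p u v g h : edge_path u p v -> U (vact a g^-1 u) -> U (vact a h^-1 v) ->
    cdist g h <= (C * size p + C)%N.
  elim: p u g => [|e p IH] u g /=.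
    by move=> -> Ug Uh; apply: leq_trans (claim _ _ _ Ug Uh) _; lia.
  move=> [eu pv] Ug Uh; have [k [f [Ff eE]]] := FE e.
  have d1 : cdist g k <= C.
    by apply: claim Ug _; rewrite -eu eE act_src vactK; right; left; exists f.
  have d2 : cdist k h <= (C * size p + C)%N.
    by apply: IH pv _ Uh; rewrite eE act_tgt vactK; right; right; exists f.
  have := ctri k g h; move: d1 d2; rewrite mulnS; lia.
exists C => g h.
have [p pP <-] := dist_path conn (vact a g o) (vact a h o).
by apply: cover pP _ _; rewrite vactK; left.
Qed.

End Comparison.
End PointedAction.

(** * The coned-off graph and hulls of quasiconvex subgroups *)

(** Quasiconvexity of [H] amounts to this set being contained in finitely many right
translates of [H]. *)
Definition geodesic_hull (G : groupType) (PP : set (subgroup G)) (S : set G)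
    (H : subgroup G) : set G :=
  [set g | exists x y c, [/\ (H : set G) x, (H : set G) y,
     @geodesic (relative_cayley PP S) x c y &
     g \in @path_vertices (relative_cayley PP S) x c]].

Lemma circuit_act (G : groupType) (K : graph) (a : graph_action G K) g (c : seq (edge K)) :
  circuit c -> circuit (map (eact a g) c).
Proof.
move=> [c0 [x cx] uc nr]; split.
- by case: c c0 {cx uc nr}.
- by exists (vact a g x); apply: edge_path_act.
- rewrite -map_comp (_ : map _ c = map (vact a g) (map (@src K) c)).
    by rewrite map_inj_uniq //; apply: vact_inj.
  by rewrite -map_comp; apply: eq_map => e /=; rewrite act_src.
- by move=> f /mapP[e ec ->]; rewrite act_erev mem_map ?nr //; apply: eact_inj.
Qed.

Section Quasiconvex.
Variables (G : groupType) (PP : set (subgroup G)) (K : graph) (a : graph_action G K).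
Variables (o : vertex K).
Hypotheses (finPP : finite_set PP) (pa : pointed_action PP a o).

Let conn := pa_connected pa.
Let tri := dist_triangle conn.
Let cone := cone_point a o.

Variable S : set G.
Hypothesis finS : finite_set S.

Definition coned_targets : set (vertex K) := (fun s => vact a s o) @` S `|` cone @` PP.

(** The coned-off Cayley graph: [g] is represented by [g o] and the coset [g P] by
[g (cone P)]. *)
Definition coned_graph : graph := orbit_graph a o coned_targets.

Definition coned_action : graph_action G coned_graph := orbit_action a o coned_targets.

Local Notation T := coned_targets.
Local Notation X := coned_graph.
Implicit Types (f : edge X) (q : seq (edge X)) (u v : vertex X).

Lemma finite_coned_targets : finite_set T.
Proof. by rewrite finite_setU; split; apply: finite_image. Qed.

Lemma coned_graph_fine : fine_graph X.
Proof.
apply: orbit_graph_fine => //; first exact: (pa_free pa).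
- exact: finite_coned_targets.
- exact: pa_edge_stabilizer pa.
- exact/fine_angle_finite/(pa_fine pa).
Qed.

Lemma coned_path_dist_le : exists C, forall u q v, edge_path u q v ->
  @dist K u v <= (C * size q)%N.
Proof.
have [C hC] := finite_bound_fun (fun t => dist o t) finite_coned_targets.
exists C => u q v; elim: q u => [|f q IH] u; first by move=> ->; rewrite distxx.
rewrite edge_path_cons => -[fu /IH qv]; have := tri (tgt f) u v.
suff d : @dist K u (tgt f) <= C by rewrite -[size (f :: q)]/(size q).+1 mulnS; lia.
rewrite -fu orbit_tgt orbit_srcE; case: f {fu qv} => [[[g t] b] fT] /=.
have Tt : T t := set_mem fT.
by case: b {fT}; rewrite dist_act // ?hC // dist_sym hC.
Qed.

Section Paths.
Variable S' : set G.
Hypothesis SS' : S' `<=` S.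
Local Notation Gamma := (relative_cayley PP S').

(** The vertex through which a peripheral edge is routed. *)
Definition cone_over (e : edge Gamma) u : Prop :=
  exists P, [/\ PP P, u = vact a (src e) (cone P) & u = vact a (tgt e) (cone P)].

Lemma coned_edge (e : edge Gamma) : exists q,
  [/\ @edge_path X (vact a (src e) o) q (vact a (tgt e) o), size q <= 2,
      forall f, f \in q -> (val f).1.1 = src e \/ (val f).1.1 = tgt e &
      forall u, u \in @path_vertices X (vact a (src e) o) q ->
        [\/ u = vact a (src e) o, u = vact a (tgt e) o | cone_over e u]].
Proof.
set x : G := src e; set y : G := tgt e.
have TP P : PP P -> T (cone P) by move=> PPP; right; exists P.
have TS s : S' s -> T (vact a s o) by move=> /SS' Ss; left; exists s.
have viaP P : PP P -> (P : set G) (x^-1 * y) -> exists q,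
  [/\ @edge_path X (vact a x o) q (vact a y o), size q <= 2,
      forall f, f \in q -> (val f).1.1 = x \/ (val f).1.1 = y &
      forall u, u \in @path_vertices X (vact a x o) q ->
        [\/ u = vact a x o, u = vact a y o | cone_over e u]].
  move=> PPP Pxy.
  have cE : vact a x (cone P) = vact a y (cone P).
    by have /(congr1 (vact a x)) := (cone_fixed pa _ PPP).1 Pxy; rewrite vactM vactVK.
  exists [:: orbit_mk a o x false (TP P PPP); orbit_mk a o y true (TP P PPP)]; split=> //.
  - by move=> f; rewrite !seq.inE => /orP[]/eqP->; [left|right].
  - move=> u; rewrite !path_vertices_cons !seq.inE !orbit_mk_tgt /=.
    move=> /or3P[]/eqP->; [by constructor 1| |by constructor 2].
    by constructor 3; exists P; split.
have [[Sxy|[_ [P PPP Pxy]]]|[Syx|[_ [P PPP Pyx]]]] := cayley_edgeP e.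
- exists [:: orbit_mk a o x false (TS _ Sxy)]; split=> //.
  + by rewrite edge_path_cons orbit_mk_src orbit_mk_tgt /= -vactM mulVKg.
  + by move=> f; rewrite !seq.inE => /eqP->; left.
  + move=> u; rewrite !path_vertices_cons !seq.inE !orbit_mk_tgt /= -vactM mulVKg.
    by move=> /orP[]/eqP->; [constructor 1|constructor 2].
- exact: viaP PPP Pxy.
- exists [:: orbit_mk a o y true (TS _ Syx)]; split=> //.
  + by rewrite edge_path_cons orbit_mk_src orbit_mk_tgt /= -vactM mulVKg.
  + by move=> f; rewrite !seq.inE => /eqP->; right.
  + move=> u; rewrite !path_vertices_cons !seq.inE !orbit_mk_tgt /=.
    by move=> /orP[]/eqP->; [constructor 1|constructor 2].
- apply: viaP PPP _; rewrite -(invgK (x^-1 * y)) invgM invgK; exact: subgroupV.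
Qed.

Lemma coned_path (x y : G) c : @edge_path Gamma x c y -> exists q,
  [/\ @edge_path X (vact a x o) q (vact a y o), (size q <= 2 * size c)%N,
      forall f, f \in q -> (val f).1.1 \in @path_vertices Gamma x c &
      forall u, u \in @path_vertices X (vact a x o) q ->
        (exists2 g : G, g \in @path_vertices Gamma x c & u = vact a g o) \/
        (exists2 e, e \in c & cone_over e u)].
Proof.
elim: c x => [|e c IH] x.
  move=> <-; exists [::]; split=> // u; rewrite seq.inE => /eqP->; left.
  by exists x => //; apply: mem_head.
rewrite edge_path_cons => -[<- /IH[q [q1 q2 q3 q4]]].
have [r [r1 r2 r3 r4]] := coned_edge e.
have srcV : (src e : G) \in @path_vertices Gamma (src e) (e :: c) by apply: mem_head.
have tailV (g : G) : g \in @path_vertices Gamma (tgt e) c ->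
    g \in @path_vertices Gamma (src e) (e :: c).
  by move=> gc; rewrite seq.inE gc orbT.
have tgtV : (tgt e : G) \in @path_vertices Gamma (src e) (e :: c).
  by apply: tailV; apply: mem_head.
exists (r ++ q); split.
- exact: edge_path_catI q1.
- by rewrite size_cat -[size (e :: c)]/(size c).+1 mulnS; lia.
- by move=> f; rewrite mem_cat => /orP[/r3[]->|/q3/tailV].
move=> u; rewrite (mem_path_vertices_cat _ _ r1) => /orP[/r4[->|->|ue]|/q4[[g gc ->]|[e' ec ue]]].
- by left; exists (src e).
- by left; exists (tgt e).
- by right; exists e => //; apply: mem_head.
- by left; exists g => //; apply: tailV.
- by right; exists e' => //; rewrite seq.inE ec orbT.
Qed.

End Paths.

(** ** The hull of a quasiconvex subgroup *)

Variables (S1 : set G) (H : subgroup G) (B : set G).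
Hypotheses (S1S : S1 `<=` S) (genS1 : relative_generating_set PP S1).
Local Notation Q := (geodesic_hull PP S1 H).
Local Notation Gamma := (relative_cayley PP S1).
Hypotheses (finB : finite_set B)
  (hullB : forall g, Q g -> exists h b, [/\ (H : set G) h, B b & g = h * b]).

Let conn1 : connected_graph Gamma := relative_cayley_connected genS1.

Lemma subgroup_hull h : (H : set G) h -> Q h.
Proof.
move=> Hh; exists h, h, [::]; split=> //.
exact: mem_head.
Qed.

Lemma hull_mul h g : (H : set G) h -> Q g -> Q (h * g).
Proof.
move=> Hh [x [y [c [Hx Hy geo gc]]]].
pose act := cayley_action (S1 `|` peripheral_elements PP).
exists (h * x), (h * y), (map (eact act h) c); split.
- exact: subgroupM.
- exact: subgroupM.
- exact: (geodesic_act act h conn1 geo).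
- by have := map_f (vact act h) gc; rewrite -(path_vertices_act act).
Qed.

Definition hull_edges : set (edge X) := [set f | Q (val f).1.1].

Definition hull_vertices : set (vertex X) :=
  [set u | exists g, Q g /\ (u = vact a g o \/ exists2 t, T t & u = vact a g t)].

Lemma hull_edges_rev f : hull_edges f -> hull_edges (erev f).
Proof. by []. Qed.

Lemma hull_edges_src f : hull_edges f -> hull_vertices (src f).
Proof.
move=> Qf; exists (val f).1.1; split=> //; case: f {Qf} => [[[g t] b] fT].
have Tt : T t := set_mem fT.
by rewrite orbit_srcE /=; case: b {fT}; [right; exists t|left].
Qed.

Lemma hull_edges_tgt f : hull_edges f -> hull_vertices (tgt f).
Proof. by move=> /hull_edges_rev /hull_edges_src. Qed.

Lemma hull_edges_act h f : (H : set G) h -> hull_edges f -> hull_edges (eact coned_action h f).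
Proof. exact: hull_mul. Qed.

Lemma hull_vertices_act h u : (H : set G) h -> hull_vertices u ->
  hull_vertices (vact coned_action h u).
Proof.
move=> Hh [g [Qg ug]]; exists (h * g); split; first exact: hull_mul.
by case: ug => [->|[t Tt ->]]; [left|right; exists t => //]; rewrite vactM.
Qed.

Definition hull_path u q v : Prop := edge_path u q v /\ forall f, f \in q -> hull_edges f.

Lemma hull_path_cat u q v r w : hull_path u q v -> hull_path v r w -> hull_path u (q ++ r) w.
Proof.
move=> [q1 q2] [r1 r2]; split; first exact: edge_path_catI r1.
by move=> f; rewrite mem_cat => /orP[/q2|/r2].
Qed.

Lemma hull_path_rev u q v : hull_path u q v -> hull_path v (rev_path q) u.
Proof.
move=> [q1 q2]; split; first exact: edge_path_rev.
by move=> f; rewrite mem_rev_path => /q2 /hull_edges_rev; rewrite erevK.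
Qed.

Lemma hull_path_act h u q v : (H : set G) h -> hull_path u q v ->
  hull_path (vact coned_action h u) (map (eact coned_action h) q) (vact coned_action h v).
Proof.
move=> Hh [q1 q2]; split; first exact: edge_path_act.
by move=> f /mapP[f0 /q2 f0q ->]; apply: hull_edges_act.
Qed.

Lemma hull_path_vertices u q v w : hull_path u q v -> hull_vertices u ->
  w \in path_vertices u q -> hull_vertices w.
Proof.
move=> [_ q2] Lu; rewrite seq.inE => /orP[/eqP->//|/mapP[f /q2 fq ->]].
exact: hull_edges_tgt.
Qed.

Lemma hull_path_subgroup h k : (H : set G) h -> (H : set G) k -> exists q,
  hull_path (vact a h o) q (vact a k o) /\ (size q <= 2 * @dist Gamma h k)%N.
Proof.
move=> Hh Hk; have [c geo] := geodesic_ex conn1 h k.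
have [q [q1 q2 q3 _]] := coned_path S1S geo.1.
exists q; split; last by rewrite (geodesic_dist_end geo).
by split=> // f /q3 fq; exists h, k, c.
Qed.

(** Up to the action of [H] there are finitely many points in the hull, and each lies
on a geodesic that ends in [H]. *)
Lemma hull_path_to_subgroup : exists C, forall g, Q g -> exists h q,
  [/\ (H : set G) h, hull_path (vact a g o) q (vact a h o) & size q <= C].
Proof.
have [C hC] : exists C, forall b, (B `&` Q) b -> exists h q,
  [/\ (H : set G) h, hull_path (vact a b o) q (vact a h o) & size q <= C].
  apply: finite_bound; first by apply: sub_finite_set finB => b [].
    move=> b [_ [x [y [c [Hx Hy geo bc]]]]].
    have [c1 [c2 [cE c1P c2P]]] := path_split geo.1 bc.
    have [q [q1 q2 q3 _]] := coned_path S1S c2P.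
    exists (size q), y, q; split=> //; split=> // f /q3 fc.
    exists x, y, c; split=> //; rewrite cE (mem_path_vertices_cat _ _ c1P).
    by apply/orP; right.
  move=> b m n mn [h [q [Hh qP qm]]]; exists h, q; split=> //; exact: leq_trans mn.
exists C => g Qg; have [k [b [Hk Bb gE]]] := hullB Qg.
have Qb : Q b by rewrite -(mulKg k b) -gE; apply: hull_mul => //; exact: subgroupV.
have [h [q [Hh qP qC]]] := hC b (conj Bb Qb).
exists (k * h), (map (eact coned_action k) q); rewrite size_map; split=> //.
  exact: subgroupM.
by have := hull_path_act Hk qP; rewrite gE !vactM.
Qed.

(** Points of the hull are at bounded distance from [H] inside the hull; geodesics of
the relative Cayley graph between points of [H] stay in the hull, and their length is
controlled by [K]. *)
Lemma hull_undistorted : exists C, forall u v, hull_vertices u -> hull_vertices v ->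
  exists q, hull_path u q v /\ size q <= (C * @dist K u v + C)%N.
Proof.
have [Cx hX] := coned_path_dist_le.
have [D hD] := hull_path_to_subgroup.
have [C1 hC1] := relative_cayley_dist_le pa genS1.
have toH u : hull_vertices u -> exists h q,
    [/\ (H : set G) h, hull_path u q (vact a h o) & size q <= D.+1].
  move=> [g [Qg ug]]; have [h [q [Hh qP qD]]] := hD g Qg; exists h.
  case: ug => [->|[t Tt ->]]; first by exists q; split=> //; lia.
  exists (orbit_mk a o g true Tt :: q); split=> //; case: qP => q1 q2; split.
    by rewrite edge_path_cons orbit_mk_src orbit_mk_tgt.
  by move=> f; rewrite seq.inE => /orP[/eqP->|/q2].
exists (2 * (C1 * (2 * (Cx * D.+1)) + C1) + 2 * D.+1 + 2 * C1)%N => u v Lu Lv.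
have [h [q [Hh qP qD]]] := toH u Lu; have [k [r [Hk rP rD]]] := toH v Lv.
have [m [mP mD]] := hull_path_subgroup Hh Hk.
exists (q ++ m ++ rev_path r); split.
  by apply: hull_path_cat qP (hull_path_cat mP (hull_path_rev rP)).
rewrite !size_cat size_rev_path.
have d1 := hX _ _ _ qP.1; have d2 := hX _ _ _ rP.1.
have d3 : @dist K (vact a h o) (vact a k o) <= (@dist K u v + 2 * (Cx * D.+1))%N.
  have := tri u (vact a h o) (vact a k o); have := tri v u (vact a k o).
  rewrite (dist_sym (vact a h o) u).
  have : (Cx * size q <= Cx * D.+1)%N by rewrite leq_mul2l qD orbT.
  have : (Cx * size r <= Cx * D.+1)%N by rewrite leq_mul2l rD orbT.
  move: d1 d2; lia.
have d4 : @dist Gamma h k <= (C1 * (@dist K u v + 2 * (Cx * D.+1)) + C1)%N.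
  by apply: leq_trans (hC1 h k) _; rewrite leq_add2r leq_mul2l d3 orbT.
move: qD rD mD d4; move: (size q) (size m) (size r) (@dist K u v) (@dist Gamma h k) (Cx * D.+1)%N.
move=> sq sm sr du dg e; nia.
Qed.

(** A cone point with infinite stabilizer in [H] lies in the hull: otherwise a path
from it to [o], its translates, and the hull itself would give infinitely many
edges at this vertex subtending bounded angles. *)
Lemma hull_contains_cone g P : PP P ->
  infinite_set [set h | (H : set G) h /\ (P : set G) (h ^ g)] ->
  hull_vertices (vact a g (cone P)).
Proof.
move=> PPP infP; apply: contrapT => nL; set v := vact a g (cone P) in nL.
have fixv h : (P : set G) (h ^ g) -> vact a h v = v.
  move=> /(cone_fixed pa _ PPP); rewrite conjgE !vactM => hP.
  by rewrite -[LHS](vactVK a g) hP.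
have [C hC] := hull_undistorted.
have Lo : hull_vertices o.
  exists 1; split; first exact/subgroup_hull/subgroup1.
  by left; rewrite vact1.
have [q0 q0P] : exists q, @edge_path X v q o.
  have [c cP] := conn1.2 g 1; have [q [q1 _ _ _]] := coned_path S1S cP.
  have TP : T (cone P) by right; exists P.
  exists (orbit_mk a o g true TP :: q); rewrite edge_path_cons orbit_mk_src orbit_mk_tgt.
  by rewrite vact1 in q1.
have [q [qP _ uq _ _]] := simple_path q0P.
case: q qP uq => [vo|f q]; first by case: nL; rewrite vo.
rewrite edge_path_cons path_vertices_cons cons_uniq => -[fv qP] /andP[vq _].
pose N := (size q + (C * (2 * @dist K v o) + C) + size q)%N.
have := fine_angle_finite coned_graph_fine v N f.
move=> fang; apply: infP.
have finj : injective (fun h => eact coned_action h f).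
  by move=> h k /(congr1 (fun f => (val f).1.1)) /= /mulIg.
apply: (@finite_setS _ _ ((fun h => eact coned_action h f) @^-1` [set f' | @angle X v N f f'])).
  by apply: finite_preimage fang => h k _ _; apply: finj.
move=> h [Hh Ph]; have hv := fixv h Ph.
suff ang : @angle X v N f (eact coned_action h f) by [].
split=> //; first by rewrite act_src fv.
have Lho : hull_vertices (vact a h o).
  by exists h; split; [exact: subgroup_hull|left].
have [r [rP rC]] := hC _ _ Lo Lho.
have qhP := edge_path_act coned_action h qP.
exists (q ++ r ++ rev_path (map (eact coned_action h) q)); split.
- apply: edge_path_catI qP _; apply: edge_path_catI rP.1 _.
  by rewrite act_tgt; apply: edge_path_rev.
- rewrite !size_cat size_rev_path size_map.
  have d : @dist K o (vact a h o) <= (2 * @dist K v o)%N.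
    have := tri v o (vact a h o); rewrite -{2}hv dist_act // (dist_sym o v); lia.
  have : (C * @dist K o (vact a h o) <= C * (2 * @dist K v o))%N by rewrite leq_mul2l d orbT.
  move: rC; rewrite /N; lia.
- rewrite (mem_path_vertices_cat _ _ qP) (mem_path_vertices_cat _ _ rP.1).
  apply/norP; split; first exact: vq.
  apply/norP; split; first by apply/negP => vr; apply: nL; apply: hull_path_vertices rP _ vr.
  rewrite (mem_path_rev _ qhP) path_vertices_act -[v]hv.
  by rewrite (mem_map (@vact_inj _ _ coned_action h)).
Qed.

End Quasiconvex.

(** * The hull as a graph with an action of the subgroup *)

Section Subgraph.
Variables (X : graph) (A : set (vertex X)) (D : set (edge X)).
Hypotheses (DA : forall e, D e -> A (src e)) (Drev : forall e, D e -> D (erev e)).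

Definition subgraph_src (e : D) : A :=
  exist (fun v => v \in A) (src (val e)) (mem_set (DA (set_mem (valP e)))).

Definition subgraph_erev (e : D) : D :=
  exist (fun e => e \in D) (erev (val e)) (mem_set (Drev (set_mem (valP e)))).

Lemma subgraph_erevK : involutive subgraph_erev.
Proof. by move=> e; apply: val_inj => /=; rewrite erevK. Qed.

Lemma subgraph_erev_neq e : subgraph_erev e != e.
Proof. by rewrite -val_eqE /= erev_neq. Qed.

Definition subgraph : graph :=
  @Graph A D subgraph_src subgraph_erev subgraph_erevK subgraph_erev_neq.

Lemma subgraph_fine : fine_graph X -> fine_graph subgraph.
Proof.
by apply: (@fine_graph_embedding subgraph X val val) => //; apply: val_inj.
Qed.

Lemma subgraph_path (x y : vertex subgraph) p : edge_path (val x) p (val y) ->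
  (forall e, e \in p -> D e) ->
  exists p' : seq (edge subgraph), edge_path x p' y /\ size p' = size p.
Proof.
elim: p x => [|e p IH] x; first by move=> /val_inj -> _; exists [::].
rewrite edge_path_cons => -[ex py] Dp.
have De : D e by apply: Dp; apply: mem_head.
pose e' : edge subgraph := exist (fun e => e \in D) e (mem_set De).
have [|p' [p1 p2]] := IH (tgt e') py; first by move=> f fp; apply: Dp; rewrite seq.inE fp orbT.
exists (e' :: p'); split; last by rewrite /= p2.
by rewrite edge_path_cons; split=> //; apply: val_inj.
Qed.

Variables (G : groupType) (a : graph_action G X).
Hypotheses (Aact : forall g v, A v -> A (vact a g v))
  (Dact : forall g e, D e -> D (eact a g e)).

Definition subgraph_vact (g : G) (v : vertex subgraph) : vertex subgraph :=
  exist (fun v => v \in A) (vact a g (val v)) (mem_set (Aact g (set_mem (valP v)))).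

Definition subgraph_eact (g : G) (e : edge subgraph) : edge subgraph :=
  exist (fun e => e \in D) (eact a g (val e)) (mem_set (Dact g (set_mem (valP e)))).

Lemma subgraph_vact1 x : subgraph_vact 1 x = x.
Proof. by apply: val_inj; rewrite /= vact1. Qed.

Lemma subgraph_vactM g h x :
  subgraph_vact (g * h) x = subgraph_vact g (subgraph_vact h x).
Proof. by apply: val_inj; rewrite /= vactM. Qed.

Lemma subgraph_eact1 e : subgraph_eact 1 e = e.
Proof. by apply: val_inj; rewrite /= eact1. Qed.

Lemma subgraph_eactM g h e :
  subgraph_eact (g * h) e = subgraph_eact g (subgraph_eact h e).
Proof. by apply: val_inj; rewrite /= eactM. Qed.

Lemma subgraph_act_src g (e : edge subgraph) :
  src (subgraph_eact g e) = subgraph_vact g (src e).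
Proof. by apply: val_inj; rewrite /= act_src. Qed.

Lemma subgraph_act_erev g (e : edge subgraph) :
  erev (subgraph_eact g e) = subgraph_eact g (erev e).
Proof. by apply: val_inj; rewrite /= act_erev. Qed.

Definition subgraph_action : graph_action G subgraph :=
  GraphAction subgraph_vact1 subgraph_vactM subgraph_eact1 subgraph_eactM
    subgraph_act_src subgraph_act_erev.

End Subgraph.

Section Restriction.
Variables (G : groupType) (X : graph) (a : graph_action G X) (H : subgroup G).

Definition restricted_action : graph_action H X.
Proof.
apply: (@GraphAction H X (fun h => vact a (val h)) (fun h => eact a (val h))).
- exact: vact1.
- by move=> g h x; rewrite -vactM.
- exact: eact1.
- by move=> g h x; rewrite -eactM.
- by move=> g e; apply: act_src.
- by move=> g e; apply: act_erev.
Defined.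

End Restriction.

Lemma finite_edge_orbits (G : groupType) (X : graph) (a : graph_action G X)
    (F : set (edge X)) : finite_set F ->
  (forall e, exists g f, F f /\ e = eact a g f) -> finite_set (range (edge_orbit a)).
Proof.
move=> fF FE; apply: finite_setS (finite_image (edge_orbit a) fF) _.
move=> _ [e _ <-]; have [g [f [Ff ->]]] := FE e; exists f => //.
apply/seteqP; split=> _ [h _ <-].
  by exists (h / g) => //; rewrite -eactM mulgVK.
by exists (h * g) => //; rewrite eactM.
Qed.

(** Vertices of one orbit have conjugate stabilizers, and [O] meets each conjugacy class
at most once. *)
Lemma finite_representatives (G : groupType) (X : graph) (a : graph_action G X)
    (F : set (vertex X)) (O : set (subgroup G)) : finite_set F ->
  (forall v, exists g f, F f /\ v = vact a g f) ->
  conjugacy_representatives (infinite_vertex_stabilizers a) O -> finite_set O.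
Proof.
move=> fF FE [OF uni].
apply: (@finite_bigcup_sub _ _ F
  (fun f => [set A | O A /\ conjugate_subgroups A (vertex_stabilizer a f)])) => //.
  move=> f _; have [ff|inff] := pselect (finite_set (vertex_stabilizer a f : set G)).
    apply: (finite_setS (@finite_set0 _)) => A [OA [g fE]].
    have [infA _] := OF _ OA; case: infA.
    apply: finite_setS (finite_image (fun x => x ^ g) ff) _ => x Ax.
    by exists (x ^ g^-1); rewrite ?fE /= -?conjgM ?mulVg ?conjg1.
  have [|B [_ Buni]] := uni (vertex_stabilizer a f); first by split=> //; exists f.
  by apply: finite_setS (finite_set1 B) _ => A /Buni.
move=> A OA; have [_ [v Av]] := OF _ OA; have [g [f [Ff vE]]] := FE v.
exists f => //; split=> //; exists g^-1; rewrite Av vE; apply/seteqP; split=> x /=.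
  by rewrite conjgE invgK !vactM vactK => ->.
by rewrite conjgE invgK !vactM vactK => /vact_inj.
Qed.

Lemma subgroup_valP (G : groupType) (H : subgroup G) (h : H) : (H : set G) (val h).
Proof. exact: set_mem (valP h). Qed.

Section HullGraph.
Variables (G : groupType) (PP : set (subgroup G)) (K : graph) (a : graph_action G K).
Variables (o : vertex K).
Hypotheses (finPP : finite_set PP) (pa : pointed_action PP a o).
Variables (S : set G) (H : subgroup G) (B : set G).
Hypotheses (finS : finite_set S) (genS : relative_generating_set PP S).
Hypotheses (finB : finite_set B)
  (hullB : forall g, geodesic_hull PP S H g ->
     exists h b, [/\ (H : set G) h, B b & g = h * b]).

Local Notation X := (coned_graph PP a o S).
Local Notation LV := (@hull_vertices G PP K a o S S H).
Local Notation LE := (@hull_edges G PP K a o S S H).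

Let srcL (e : edge X) : LE e -> LV (src e) := @hull_edges_src G PP K a o S S H e.
Let revL (e : edge X) : LE e -> LE (erev e) := @hull_edges_rev G PP K a o S S H e.

Let aH : graph_action H X := restricted_action (coned_action PP a o S) H.

Let actV (h : H) v : LV v -> LV (vact aH h v).
Proof. exact: (hull_vertices_act genS (subgroup_valP h)). Qed.

Let actE (h : H) e : LE e -> LE (eact aH h e).
Proof. exact: (hull_edges_act genS (subgroup_valP h)). Qed.

Definition hull_graph : graph := subgraph srcL revL.
Definition hull_action : graph_action H hull_graph := subgraph_action srcL revL actV actE.

Local Notation Y := hull_graph.
Local Notation cone := (cone_point a o).

Let Lo : LV o.
Proof.
by exists 1; split; [exact/subgroup_hull/subgroup1|left; rewrite vact1].
Qed.

Let hull_within : exists C, forall u v : vertex Y,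
  within_distance (C * @dist K (val u) (val v) + C)%N u v.
Proof.
have [C hC] := hull_undistorted finPP pa finS (@subset_refl _ S) genS finB hullB.
exists C => u v; have [q [[q1 q2] qC]] := hC _ _ (set_mem (valP u)) (set_mem (valP v)).
have [q' [q'P sq]] := @subgraph_path X LV LE srcL revL u v q q1 q2.
by exists q' => //; rewrite sq.
Qed.

Lemma hull_graph_connected : connected_graph Y.
Proof.
split; first by exists (exist (fun v => v \in LV) o (mem_set Lo)).
move=> u v; have [C hC] := hull_within; have [p pP _] := hC u v; by exists p.
Qed.

Lemma hull_graph_hyperbolic : exists delta, hyperbolic_graph Y delta.
Proof.
have [delta hyp] := pa_hyperbolic pa; have conn := pa_connected pa.
have [C1 hC1] := hull_within; have [C2 hC2] := coned_path_dist_le finPP pa finS.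
apply: (@hyperbolic_qi_embedding K delta conn hyp Y val (C1 + C2)).
- exact: hull_graph_connected.
- move=> e; have := hC2 (src (val e)) [:: val e] (tgt (val e)).
  rewrite /= muln1 => h; apply: leq_trans (h _) (leq_addl _ _).
  by split.
- move=> u v; apply: leq_trans (dist_le (hC1 u v)) _; nia.
Qed.

Lemma hull_edge_stabilizer (e : edge Y) : finite_set (edge_stabilizer hull_action e).
Proof.
apply: finite_setS (finite_set1 1) _ => h [he|he].
  have /(congr1 (fun u : edge X => (val u).1.1)) := congr1 val he.
  move=> /= hg; apply: val_inj => /=.
  by apply: (mulIg (val (val e)).1.1); rewrite mul1g.
have /(congr1 (fun u : edge X => (val u).2)) := congr1 val he.
by move=> /=; case: (val (val e)).2.
Qed.

Lemma hull_edge_representatives : exists F : set (edge Y), finite_set F /\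
  forall e, exists h f, F f /\ e = eact hull_action h f.
Proof.
exists ((fun e : edge Y => val (val e)) @^-1` ((B `*` coned_targets PP a o S) `*` [set: bool])).
split.
  apply: finite_preimage => [e e' _ _ /val_inj /val_inj//|].
  apply: finite_setX; last exact: finite_finset.
  by apply: finite_setX => //; apply: finite_coned_targets.
move=> e; have Qe : LE (val e) := set_mem (valP e).
have [h [b [Hh Bb gE]]] := hullB Qe.
pose k : H := exist (fun x => x \in (H : set G)) h (mem_set Hh).
exists k, (eact hull_action k^-1 e); split; last by rewrite eactVK.
split=> //; split=> /=; first by rewrite gE mulKg.
exact: set_mem (valP (val e)).
Qed.

Lemma hull_vertex_representatives : exists F : set (vertex Y), finite_set F /\
  forall v, exists h f, F f /\ v = vact hull_action h f.
Proof.
exists (val @^-1` ((fun bt : G * vertex K => vact a bt.1 bt.2) @`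
   (B `*` ([set o] `|` coned_targets PP a o S)))).
split.
  apply: finite_preimage => [v v' _ _ /val_inj//|].
  apply: finite_image; apply: finite_setX => //.
  by rewrite finite_setU; split; [exact: finite_set1|exact: finite_coned_targets].
move=> v; have [g [Qg gv]] : LV (val v) := set_mem (valP v).
have [h [b [Hh Bb gE]]] := hullB Qg.
pose k : H := exist (fun x => x \in (H : set G)) h (mem_set Hh).
exists k, (vact hull_action k^-1 v); split; last by rewrite vactVK.
have vE t : val v = vact a g t -> val (vact hull_action k^-1 v) = vact a b t.
  by move=> /= ->; rewrite -vactM gE mulKg.
case: gv => [/vE vb|[t Tt /vE vb]]; rewrite /preimage /mkset vb.
  by exists (b, o) => //; split=> //; left.
by exists (b, t) => //; split=> //; right.
Qed.

(** Orbit points have trivial stabilizers and cone points have the subgroups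
[H `&` g P g^-1] as stabilizers; all infinite ones occur because their cone points
belong to the hull. *)
Lemma hull_stabilizers :
  infinite_vertex_stabilizers hull_action = peripheral_intersections PP H.
Proof.
have orb (v : vertex Y) g : val v = vact a g o ->
    finite_set (vertex_stabilizer hull_action v : set H).
  move=> vg; apply: finite_setS (finite_set1 1) _ => h /(congr1 val) /=.
  rewrite vg -vactM => /(free_inj (pa_free pa)) hg; apply: val_inj => /=.
  by apply: (mulIg g); rewrite mul1g.
have coneE (v : vertex Y) g P : PP P -> val v = vact a g (cone P) ->
    (vertex_stabilizer hull_action v : set H) = [set h | (P : set G) (val h ^ g)].
  move=> PPP vg; apply/seteqP; split=> h /=.
    move=> /(congr1 val) /= hv; apply/(cone_fixed pa _ PPP).
    by rewrite conjgE !vactM -vg hv vg vactK.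
  move=> /(cone_fixed pa _ PPP); rewrite conjgE !vactM -vg => hv; apply: val_inj => /=.
  by rewrite -[LHS](vactVK a g) hv vg.
apply/seteqP; split=> A [infA].
  move=> [v vE]; split=> //; have [g [Qg gv]] : LV (val v) := set_mem (valP v).
  have vinf : ~ finite_set (vertex_stabilizer hull_action v : set H) by rewrite -vE.
  case: gv => [/orb//|[t [[s Ss <-]|[P PPP <-]] gv]].
    by case: vinf; apply: (orb v (g * s)); rewrite gv vactM.
  by exists g, P; split=> //; rewrite vE (coneE v g P).
move=> [g [P [PPP AE]]]; split=> //.
have Lv : LV (vact a g (cone P)).
  apply: (hull_contains_cone finPP pa finS (@subset_refl _ S) genS finB hullB PPP).
  apply: contra_not infA => fin; rewrite AE.
  apply: (@finite_setS _ _ (val @^-1` [set h | (H : set G) h /\ (P : set G) (h ^ g)])).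
    by apply: finite_preimage fin => x y _ _; apply: val_inj.
  by move=> h Ph; split=> //; apply: subgroup_valP.
exists (exist (fun v => v \in LV) _ (mem_set Lv)).
by rewrite AE (coneE _ g P).
Qed.

Lemma hull_relatively_hyperbolic (O : set (subgroup H)) :
  induced_peripheral_structure PP O -> relatively_hyperbolic O.
Proof.
rewrite /induced_peripheral_structure -hull_stabilizers => OF.
have [FV [finFV FVE]] := hull_vertex_representatives.
have [FE [finFE FEE]] := hull_edge_representatives.
split; first exact: finite_representatives finFV FVE OF.
exists Y, hull_action; split; split=> //.
- exact: hull_graph_connected.
- exact: hull_graph_hyperbolic.
- exact/subgraph_fine/coned_graph_fine.
- exact: hull_edge_stabilizer.
- exact: finite_edge_orbits finFE FEE.
Qed.

End HullGraph.

Lemma near_translate (R : realType) (G : groupType) (d : G -> G -> R) kappa g h :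
  is_metric d -> left_invariant d ->
  (d g h <= kappa)%R -> (d 1%g (h^-1 * g)%g <= kappa)%R.
Proof.
by move=> [_ _ dsym _] linv gh; rewrite -(linv h) mulg1 mulVKg dsym.
Qed.

(** The translating elements can be taken in a ball, which is finite. *)
Lemma quasiconvex_hull (R : realType) (G : groupType) (PP : set (subgroup G))
    (H : subgroup G) : relatively_quasiconvex R PP H ->
  exists S B, [/\ finite_set S, relative_generating_set PP S, finite_set B &
    forall g, geodesic_hull PP S H g -> exists h b, [/\ (H : set G) h, B b & g = h * b]].
Proof.
move=> [S [d [kappa [[finS genS [met proper linv]] qc]]]].
exists S, [set y | (d 1%g y <= kappa)%R]; split=> // g [x [y [c [Hx Hy geo gc]]]].
have [h Hh gh] := qc x y c Hx Hy geo g gc.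
exists h, (h^-1 * g); rewrite mulVKg; split=> //.
exact: near_translate gh.
Qed.

(** * Two routes to the hull *)

Section HullLinks.
Variables (G : groupType) (PP : set (subgroup G)) (K : graph) (a : graph_action G K).
Variables (o : vertex K).
Hypotheses (finPP : finite_set PP) (pa : pointed_action PP a o).
Variables (S S1 : set G) (H : subgroup G) (B : set G).
Hypotheses (finS : finite_set S) (S1S : S1 `<=` S).
Hypotheses (genS1 : relative_generating_set PP S1).
Hypotheses (finB : finite_set B)
  (hullB : forall g, geodesic_hull PP S1 H g ->
     exists h b, [/\ (H : set G) h, B b & g = h * b]).

Local Notation X := (coned_graph PP a o S).
Local Notation LV := (@hull_vertices G PP K a o S S1 H).
Local Notation LE := (@hull_edges G PP K a o S S1 H).
Local Notation T := (coned_targets PP a o S).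
Local Notation cone := (cone_point a o).

Lemma hull_vertex_translates : exists B' : set G, finite_set B' /\
  forall g, LV (vact a g o) -> exists h b, [/\ (H : set G) h, B' b & g = h * b].
Proof.
exists (B `|` (fun bs => bs.1 * bs.2) @` (B `*` S)); split.
  by rewrite finite_setU; split=> //; apply/finite_image/finite_setX.
move=> g [k [/hullB[h [b [Hh Bb ->]]]]]; move=> [/(free_inj (pa_free pa)) ->|].
  by exists h, b; split=> //; left.
move=> [t [[s Ss <-]|[P PPP <-]] gt]; last by case: (cone_not_orbit pa (g := h * b) (h := g) PPP).
exists h, (b * s); split=> //; first by right; exists (b, s).
by rewrite mulgA; apply: (free_inj (pa_free pa)); rewrite gt -vactM.
Qed.

(** Two routes of bounded length from [g o] to the hull that meet only at [g o],
closed up inside the hull, yield a circuit of bounded length through an edge of the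
hull; by fineness there are finitely many of these up to the action of [H]. *)
Lemma hull_two_routes N : exists B' : set G, finite_set B' /\
  forall g (r1 r2 : seq (edge X)) l1 l2,
    @edge_path X (vact a g o) r1 l1 -> @edge_path X (vact a g o) r2 l2 ->
    LV l1 -> LV l2 -> size r1 <= N -> size r2 <= N ->
    (forall u, u \in @path_vertices X (vact a g o) r1 ->
       u \in @path_vertices X (vact a g o) r2 -> u = vact a g o) ->
    exists h b, [/\ (H : set G) h, B' b & g = h * b].
Proof.
have [B1 [finB1 hB1]] := hull_vertex_translates.
have [C hC] := hull_undistorted finPP pa finS S1S genS1 finB hullB.
have [Cx hCx] := coned_path_dist_le finPP pa finS.
pose N' := (N + (C * (Cx * (N + N)) + C) + N)%N.
pose F : set (edge X) := [set f | ((B `*` T) `*` [set: bool]) (val f)].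
have finF : finite_set F.
  apply: finite_preimage; first by move=> e e' _ _; apply: val_inj.
  apply: finite_setX; last exact: finite_finset.
  by apply: finite_setX => //; apply: finite_coned_targets.
pose B2 : set G := \bigcup_(f in F) \bigcup_(m in `I_N'.+1)
  \bigcup_(c in [set c | [/\ circuit c, size c = m & f \in c]])
    [set k | vact a k o \in map (@src X) c].
exists (B1 `|` B2); split.
  rewrite finite_setU; split=> //; apply: bigcup_finite => // f _.
  apply: bigcup_finite => [|m _]; first exact: finite_II.
  apply: bigcup_finite => [|c _]; first exact: coned_graph_fine.
  apply: (@finite_setS _ _ ((fun k => vact a k o) @^-1` [set` map (@src X) c])) => //.
  by apply: finite_preimage (finite_seq _) => k k' _ _; apply: (free_inj (pa_free pa)).
move=> g r1 r2 l1 l2 r1P r2P Ll1 Ll2 r1N r2N meet.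
have [/hB1[h [b [Hh Bb gE]]]|nLg] := pselect (LV (vact a g o)).
  by exists h, b; split=> //; left.
have shortcut r l : @edge_path X (vact a g o) r l -> LV l -> size r <= N ->
    exists q z, [/\ @edge_path X (vact a g o) q z, LV z, size q <= N,
      {subset @path_vertices X (vact a g o) q <= @path_vertices X (vact a g o) r} &
      uniq (@path_vertices X (vact a g o) q) /\ forall e, e \in q -> ~ LV (src e)].
  move=> rP Ll rN; have [r' [z [r'P Lz sr' vr' nr']]] := first_visit rP Ll.
  have [q [qP sq uq er' vq]] := simple_path r'P.
  exists q, z; split=> //; [by lia|by move=> u /vq /vr'|split=> // e /er'; exact: nr'].
have [q1 [z1 [q1P Lz1 q1N vq1 [uq1 nq1]]]] := shortcut _ _ r1P Ll1 r1N.
have [q2 [z2 [q2P Lz2 q2N vq2 [uq2 nq2]]]] := shortcut _ _ r2P Ll2 r2N.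
have meetq u : u \in @path_vertices X (vact a g o) q1 ->
    u \in @path_vertices X (vact a g o) q2 -> u = vact a g o.
  by move=> /vq1 u1 /vq2 u2; apply: meet.
have z12 : z1 <> z2.
  move=> z12; apply: nLg; rewrite -(meetq z1) //; first exact: mem_path_end q1P.
  by rewrite z12; exact: mem_path_end q2P.
have [m0 [m0P m0C]] := hC _ _ Lz1 Lz2.
have [m [mP sm um em _]] := simple_path m0P.1.
have mL : hull_path S1 H z1 m z2 by split=> // e /em /m0P.2.
have dz : @dist K z1 z2 <= (Cx * (N + N))%N.
  have := hCx _ _ _ (edge_path_catI (edge_path_rev q1P) q2P).
  move/leq_trans; apply; rewrite size_cat size_rev_path leq_mul2l.
  by apply/orP; right; apply: leq_add.
have mN : size m <= (C * (Cx * (N + N)) + C)%N.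
  apply: leq_trans sm (leq_trans m0C _); rewrite leq_add2r leq_mul2l dz.
  by rewrite orbT.
have mem2 u : LV u -> u \in @path_vertices X (vact a g o) q2 -> u = z2.
  move=> Lu; rewrite (path_vertices_src q2P) mem_rcons seq.inE => /orP[/eqP//|].
  by move=> /mapP[e /nq2 nLe ue]; case: nLe; rewrite -ue.
pose c := q1 ++ m ++ rev_path q2.
have cP : @edge_path X (vact a g o) c (vact a g o).
  exact: edge_path_catI q1P (edge_path_catI mP (edge_path_rev q2P)).
have q1n : q1 <> [::] by move=> q1E; move: q1P; rewrite q1E => /= z1E; apply: nLg; rewrite z1E.
have q2n : q2 <> [::] by move=> q2E; move: q2P; rewrite q2E => /= z2E; apply: nLg; rewrite z2E.
have mn : m <> [::] by move=> mE; move: mP; rewrite mE.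
have srcrev : map (@src X) (rev_path q2) = rev (map (@tgt X) q2).
  by rewrite /rev_path map_rev -map_comp.
have cc : circuit c.
  apply: (circuit_criterion _ cP).
  - by rewrite /c; case: q1 q1n {q1P q1N vq1 uq1 nq1 meetq cP c}.
  - have u1 : uniq (map (@src X) q1).
      by move: uq1; rewrite (path_vertices_src q1P) rcons_uniq => /andP[].
    have [z2m um'] : z2 \notin map (@src X) m /\ uniq (map (@src X) m).
      by move: um; rewrite (path_vertices_src mP) rcons_uniq => /andP[].
    have [gq2 u2] : vact a g o \notin map (@tgt X) q2 /\ uniq (map (@tgt X) q2).
      by move: uq2; rewrite /path_vertices cons_uniq => /andP[].
    have tq2 u : u \in map (@tgt X) q2 -> u \in @path_vertices X (vact a g o) q2.
      by move=> uq; rewrite seq.inE uq orbT.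
    have sq1 u : u \in map (@src X) q1 -> u \in @path_vertices X (vact a g o) q1 /\ ~ LV u.
      move=> /mapP[e eq1 ->]; split; last exact: nq1.
      exact: mem_path_src q1P eq1.
    have sm' u : u \in map (@src X) m -> LV u.
      by move=> /mapP[e /mL.2 /hull_edges_src Le ->].
    rewrite !map_cat srcrev cat_uniq u1 cat_uniq um' rev_uniq u2 /= andbT.
    apply/andP; split; apply/hasPn => u.
      rewrite mem_cat mem_rev => /orP[/sm' Lu|ut]; apply/negP => /sq1[uq nLu] //.
      by move: gq2; rewrite -(meetq _ uq (tq2 _ ut)) ut.
    rewrite mem_rev => ut; apply/negP => us.
    by move: z2m; rewrite -(mem2 u (sm' _ us) (tq2 _ ut)) us.
  - move=> e cE; have : size c = 2 by rewrite cE.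
    rewrite /c !size_cat size_rev_path.
    by move: q1n q2n mn; case: (q1) (q2) (m) => [//|? ?] [//|? ?] [//|? ?] _ _ _ /=; lia.
have cN : size c <= N' by rewrite /c !size_cat size_rev_path /N'; lia.
have [f fm] : exists f, f \in m by case: (m) mn => // f m' _; exists f; apply: mem_head.
have [h [b [Hh Bb fE]]] := hullB (mL.2 f fm).
exists h, (h^-1 * g); rewrite mulVKg; split=> //; right.
pose act := coned_action PP a o S.
exists (eact act h^-1 f).
  split=> //; split=> /=; first by rewrite fE mulKg.
  exact: set_mem (valP f).
exists (size c) => //; exists (map (eact act h^-1) c).
  rewrite /mkset size_map; split=> //; first exact: circuit_act.
  by apply: map_f; rewrite !mem_cat fm orbT.
have [e eq1 eg] : exists2 e, e \in q1 & src e = vact a g o.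
  case: (q1) q1n q1P => // e q _; rewrite edge_path_cons => -[eg _].
  by exists e => //; apply: mem_head.
rewrite /mkset -map_comp; apply/mapP; exists e; first by rewrite mem_cat eq1.
by rewrite vactM -eg; apply/esym; apply: (act_src act).
Qed.

End HullLinks.

(** * Change of relative generating set *)

Lemma quasigeodesic_mono (K : graph) C C' n (c : nat -> vertex K) : C <= C' ->
  quasigeodesic C n c -> quasigeodesic C' n c.
Proof.
move=> CC [lip low]; split=> [i /lip d|i j /low d]; first exact: leq_trans CC.
by apply: leq_trans d _; rewrite leq_add // leq_mul2r CC orbT.
Qed.

Section ChangeOfGenerators.
Variables (G : groupType) (PP : set (subgroup G)) (K : graph) (a : graph_action G K).
Variables (o : vertex K).
Hypotheses (finPP : finite_set PP) (pa : pointed_action PP a o).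
Let conn := pa_connected pa.
Let tri := dist_triangle conn.
Local Notation cone := (cone_point a o).

Lemma relative_geodesic_quasigeodesic (S : set G) : finite_set S ->
  relative_generating_set PP S -> exists C, forall x c y,
  @geodesic (relative_cayley PP S) x c y ->
  quasigeodesic C (size c)
    (fun i => vact a (nth x (@path_vertices (relative_cayley PP S) x c) i) o).
Proof.
move=> finS genS; have [C1 h1] := relative_cayley_lipschitz finPP pa finS.
have [C2 h2] := relative_cayley_dist_le pa genS.
exists (C1 + C2) => x c y geo; split=> [i ic|i j ij].
  have [e <- <-] := path_nth_edge geo.1 ic.
  by apply: leq_trans (h1 e) _; apply: leq_addr.
rewrite -(geodesic_nth_dist geo ij); apply: leq_trans (h2 _ _) _.
by rewrite leq_add ?leq_mul2r ?leq_addl ?orbT.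
Qed.

Variables (S1 S2 : set G) (H : subgroup G) (B : set G).
Hypotheses (finS1 : finite_set S1) (finS2 : finite_set S2).
Hypotheses (genS1 : relative_generating_set PP S1) (genS2 : relative_generating_set PP S2).
Hypotheses (finB : finite_set B)
  (hullB : forall g, geodesic_hull PP S1 H g ->
     exists h b, [/\ (H : set G) h, B b & g = h * b]).

Let S := S1 `|` S2.
Let finS : finite_set S. Proof. by rewrite finite_setU. Qed.
Let S1S : S1 `<=` S. Proof. by left. Qed.
Let S2S : S2 `<=` S. Proof. by right. Qed.

Local Notation X := (coned_graph PP a o S).
Local Notation LV := (@hull_vertices G PP K a o S S1 H).
Local Notation Gamma := (relative_cayley PP S2).

(** Geodesics of the two Cayley graphs with the same ends map to quasi-geodesics of [K]
with the same ends, which stay close. *)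
Lemma geodesic_near_hull : exists M, forall x c y,
  (H : set G) x -> (H : set G) y -> @geodesic Gamma x c y ->
  forall g : G, g \in @path_vertices Gamma x c ->
  exists (r : seq (edge X)) l, [/\ @edge_path X (vact a g o) r l, LV l & size r <= M].
Proof.
have [delta hyp] := pa_hyperbolic pa.
have [C1 h1] := relative_geodesic_quasigeodesic finS1 genS1.
have [C2 h2] := relative_geodesic_quasigeodesic finS2 genS2.
have [M hM] := quasigeodesics_close conn hyp (C1 + C2).
have [C3 h3] := relative_cayley_dist_le pa genS1.
have conn1 := relative_cayley_connected genS1.
exists (2 * (C3 * M + C3))%N => x c y Hx Hy geo g gc.
have [c' geo'] := geodesic_ex conn1 x y.
have ic : index g (@path_vertices Gamma x c) <= size c.
  by rewrite -ltnS; move: gc; rewrite -index_mem /path_vertices /= size_map.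
have qg := quasigeodesic_mono (leq_addl C1 C2) (h2 _ _ _ geo).
have qg' := quasigeodesic_mono (leq_addr C2 C1) (h1 _ _ _ geo').
have endE (S' : set G) (p : seq (edge (relative_cayley PP S'))) :
    @geodesic (relative_cayley PP S') x p y ->
    nth x (@path_vertices (relative_cayley PP S') x p) (size p) = y.
  by move=> gp; rewrite -(edge_path_last gp.1) (last_nth x) size_map.
have [||j jc' d] := hM _ _ _ _ _ qg qg' _ _ ic; first by [].
  by rewrite (endE _ _ geo) (endE _ _ geo').
rewrite nth_index // in d; set g' := nth x _ j in d.
have Qg' : geodesic_hull PP S1 H g'.
  by exists x, y, c'; split=> //; rewrite mem_nth //= size_map ltnS.
have [p pP ps] := dist_path conn1 g g'.
have [q [q1 q2 _ _]] := coned_path pa S1S pP.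
exists q, (vact a g' o); split=> //; first by exists g'; split=> //; left.
apply: leq_trans q2 _; rewrite ps leq_mul2l; apply/orP; right.
by apply: leq_trans (h3 g g') _; rewrite leq_add2r leq_mul2l d orbT.
Qed.

Let cone_at (x : G) (c : seq (edge Gamma)) k (u : vertex X) : Prop :=
  let v i := nth x (@path_vertices Gamma x c) i in
  u = vact a (v k) o \/ k < size c /\
  exists P, [/\ PP P, u = vact a (v k) (cone P) & u = vact a (v k.+1) (cone P)].

Let coned_subpath x c y i j : @edge_path Gamma x c y -> i <= j <= size c ->
  let v i := nth x (@path_vertices Gamma x c) i in
  exists q, [/\ @edge_path X (vact a (v i) o) q (vact a (v j) o),
    (size q <= 2 * (j - i))%N &
    forall u, u \in @path_vertices X (vact a (v i) o) q ->
      exists2 k, i <= k <= j & cone_at x c k u /\ (k = j -> u = vact a (v k) o)].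
Proof.
move=> cP ij v; have [p [p1 p2 p3 p4]] := subpath cP ij.
have [q [q1 q2 _ q4]] := coned_path pa S2S p1.
exists q; split=> //; first by rewrite -p2.
move=> u /q4[[g /p3[k kij ->] ->]|[e /p4[k kij [es et]] [P [PPP us ut]]]].
  by exists k => //; split=> //; left.
exists k; first by lia.
split=> [|kj]; last by lia.
right; split; first by move: ij kij; lia.
by exists P; split=> //; [rewrite us es|rewrite ut et].
Qed.

(** Cutting a geodesic at a vertex [g] gives two half-paths in the coned graph.
Following each for a long but bounded time and then jumping to the hull gives two
routes; since quasi-geodesics do not backtrack they meet only at [g]. *)
Lemma hull_of_other_generators : exists B' : set G, finite_set B' /\
  forall g, geodesic_hull PP S2 H g -> exists h b, [/\ (H : set G) h, B' b & g = h * b].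
Proof.
have [C hC] := relative_geodesic_quasigeodesic finS2 genS2.
have [M hM] := geodesic_near_hull.
have [Cx hX] := coned_path_dist_le finPP pa finS.
have [D0 hD0] := finite_bound_fun (fun P => dist o (cone P)) finPP.
pose D1 := (Cx * M)%N.
(* Points of the geodesic whose indices differ by [R] are too far apart in [K] to have
   neighbours in common: [D0] bounds the excursion to a cone point, and [D1] the jump
   from the geodesic to the hull. *)
pose R := (C * (D0 + 2 * D1) + C).+1%N.
have [B' [finB' hB']] := hull_two_routes finPP pa finS S1S genS1 finB hullB (2 * R + M)%N.
exists B'; split=> // g [x [y [c [Hx Hy geo gc]]]].
pose v i : G := nth x (@path_vertices Gamma x c) i.
have cP := geo.1; have vd := geodesic_nth_dist geo; have qg := hC _ _ _ geo.
have gap := quasigeodesic_gap qg.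
pose n := size c; pose i := index g (@path_vertices Gamma x c).
have ic : i <= n by rewrite -ltnS; move: gc; rewrite -index_mem /= size_map.
have vi : v i = g by apply: nth_index.
have vmem k : k <= n -> v k \in @path_vertices Gamma x c.
  by move=> kn; apply: mem_nth; rewrite /= size_map.
have Lv k : (H : set G) (v k) -> LV (vact a (v k) o).
  by move=> Hk; exists (v k); split; [apply: subgroup_hull|left].
have v0 : v 0 = x by [].
have vn : v n = y by rewrite /v -(edge_path_last cP) (last_nth x) size_map.
have atd k u : cone_at x c k u -> @dist K u (vact a (v k) o) <= D0.
  move=> [->|[_ [P [PPP -> _]]]]; first by rewrite distxx.
  by rewrite dist_act // dist_sym hD0.
have jump k : k <= n -> exists (r : seq (edge X)) l,
    [/\ @edge_path X (vact a (v k) o) r l, LV l, size r <= M &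
     forall u, u \in @path_vertices X (vact a (v k) o) r -> @dist K u (vact a (v k) o) <= D1].
  move=> kn; have [r [l [rP Ll rM]]] := hM _ _ _ Hx Hy geo _ (vmem k kn).
  exists r, l; split=> // u ur; have [r1 [r2 [rE r1P _]]] := path_split rP ur.
  rewrite dist_sym; apply: leq_trans (hX _ _ _ r1P) _; rewrite leq_mul2l; apply/orP; right.
  by move: rM; rewrite rE size_cat; lia.
have forwards : exists (r : seq (edge X)) l,
    [/\ @edge_path X (vact a g o) r l, LV l, (size r <= 2 * R + M)%N &
     forall u, u \in @path_vertices X (vact a g o) r ->
       (exists k, [/\ i <= k, k <= n & cone_at x c k u]) \/
       (i + R <= n /\ @dist K u (vact a (v (i + R)) o) <= D1)].
  rewrite -vi; have [iR|iR] := leqP (i + R) n.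
    have [|q [q1 q2 q3]] := @coned_subpath x c y i (i + R) cP; first by lia.
    have [r [l [rP Ll rM rD]]] := jump _ iR.
    exists (q ++ r), l; split=> //; first exact: edge_path_catI rP.
      by rewrite size_cat; lia.
    move=> u; rewrite (mem_path_vertices_cat _ _ q1) => /orP[/q3[k kij [uk _]]|/rD ur].
      by left; exists k; split=> //; lia.
    by right.
  have [|q [q1 q2 q3]] := @coned_subpath x c y i n cP; first by lia.
  exists q, (vact a (v n) o); split=> //.
  - by apply: Lv; rewrite vn.
  - by lia.
  - by move=> u /q3[k kij [uk _]]; left; exists k; split=> //; lia.
have backwards : exists (r : seq (edge X)) l,
    [/\ @edge_path X (vact a g o) r l, LV l, (size r <= 2 * R + M)%N &
     forall u, u \in @path_vertices X (vact a g o) r ->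
       (exists k, [/\ k <= i, cone_at x c k u & k = i -> u = vact a (v k) o]) \/
       (R <= i /\ @dist K u (vact a (v (i - R)) o) <= D1)].
  rewrite -vi; have [iR|iR] := leqP R i.
    have [|q [q1 q2 q3]] := @coned_subpath x c y (i - R) i cP; first by lia.
    have [|r [l [rP Ll rM rD]]] := jump (i - R); first by lia.
    exists (rev_path q ++ r), l; split=> //; first exact: edge_path_catI (edge_path_rev q1) rP.
      by rewrite size_cat size_rev_path; lia.
    move=> u; rewrite (mem_path_vertices_cat _ _ (edge_path_rev q1)) (mem_path_rev _ q1).
    move=> /orP[/q3[k kij [uk uki]]|/rD ur]; last by right.
    by left; exists k; split=> //; lia.
  have [|q [q1 q2 q3]] := @coned_subpath x c y 0 i cP; first by lia.
  exists (rev_path q), (vact a (v 0) o); split=> //; first exact: edge_path_rev.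
  - exact: Lv.
  - by rewrite size_rev_path; lia.
  - move=> u; rewrite (mem_path_rev _ q1) => /q3[k kij [uk uki]].
    by left; exists k; split=> //; lia.
have [r1 [l1 [r1P Ll1 r1s r1u]]] := forwards.
have [r2 [l2 [r2P Ll2 r2s r2u]]] := backwards.
apply: (hB' g r1 r2 l1 l2) => // u /r1u u1 /r2u u2; rewrite -vi.
have far k l d : k <= n -> l <= n -> k + R <= l ->
    @dist K (vact a (v k) o) (vact a (v l) o) <= d -> d <= D0 + 2 * D1 -> False.
  move=> kn ln kl dkl dD; have := gap k l kn ln.
  have : (C * @dist K (vact a (v k) o) (vact a (v l) o) <= C * (D0 + 2 * D1))%N.
    by rewrite leq_mul2l (leq_trans dkl dD) orbT.
  by rewrite /R in kl; rewrite -/(v k) -/(v l); lia.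
have via k l d1 d2 : @dist K u (vact a (v k) o) <= d1 -> @dist K u (vact a (v l) o) <= d2 ->
    @dist K (vact a (v k) o) (vact a (v l) o) <= d1 + d2.
  by move=> h1 h2; have := tri u (vact a (v k) o) (vact a (v l) o);
    rewrite (dist_sym (vact a (v k) o) u); lia.
(* A common vertex lies on the two halves of the geodesic, or one of the jumps to the
   hull is involved and points [R] apart would be close. *)
case: u1 u2 => [[k [ik kn uk]]|[iR du]] [[l [li ul uli]]|[Ri dv]]; last first.
- by have := far _ _ _ _ _ _ (via _ _ _ _ dv du); case; lia.
- by have := far _ _ _ _ _ _ (via _ _ _ _ (atd _ _ ul) du); case; lia.
- by have := far _ _ _ _ _ _ (via _ _ _ _ dv (atd _ _ uk)); case; lia.
have vinj k' l' : k' <= l' <= n -> v k' = v l' -> k' = l'.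
  by move=> kl ve; have := vd _ _ kl; rewrite -/(v k') -/(v l') ve distxx; lia.
case: uk => [uk|[kn' [P [PPP uk uk']]]].
  have [li'|li'] := eqVneq l i; first by rewrite -li'; apply: uli.
  case: ul => [ul'|[_ [P [PPP ul' _]]]].
    have vkl : v l = v k by apply: (free_inj (pa_free pa)); rewrite -[RHS]uk -ul'.
    have lk : l <= k <= n by lia.
    by have := vinj _ _ lk vkl; lia.
  by case: (cone_not_orbit pa (g := v l) (h := v k) PPP); rewrite -[RHS]uk -ul'.
have [li'|li'] := eqVneq l i; first by rewrite -li'; apply: uli.
case: ul => [ul'|[_ [P' [PPP' ul' _]]]].
  by case: (cone_not_orbit pa (g := v k) (h := v l) PPP); rewrite -[RHS]ul' -uk.
have [_ Pkl] : P' = P /\ (P' : set G) ((v l)^-1 * v k.+1).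
  by apply: (cone_eq pa PPP' PPP); rewrite -[RHS]uk' -ul'.
(* Both halves pass through the same coset, so a single peripheral edge would shortcut
   the geodesic from [v l] to [v k.+1]. *)
have d1 : @dist Gamma (v l) (v k.+1) <= 1.
  apply/dist_le/cayley_within_gen; right; split; last by exists P'.
  move=> /mulg1_eq; rewrite invgK => vlk.
  have lk : l <= k.+1 <= n by lia.
  by have := vinj _ _ lk vlk; lia.
have lk : l <= k.+1 <= size c by move: kn'; lia.
by have := vd _ _ lk; move: d1; rewrite /v => d1 d2; rewrite d2 in d1; lia.
Qed.

End ChangeOfGenerators.

(** * The theorem *)

(** For given [b1] and [b2], any two elements common to [H1 b1] and [H2 b2] differ by an
element of both subgroups; one common element for each pair suffices. *)
Lemma intersection_translates (G : groupType) (H1 H2 : subgroup G) (B1 B2 : set G) :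
  finite_set B1 -> finite_set B2 -> exists D : set G, finite_set D /\
  forall g, (exists h b, [/\ (H1 : set G) h, B1 b & g = h * b]) ->
    (exists h b, [/\ (H2 : set G) h, B2 b & g = h * b]) ->
    exists h z, [/\ (subgroupI H1 H2 : set G) h, D z & g = h * z].
Proof.
move=> fB1 fB2.
pose common (b : G * G) g := (H1 : set G) (g / b.1) /\ (H2 : set G) (g / b.2).
have /choice[z hz] : forall b, exists z, (exists g, common b g) -> common b z.
  by move=> b; have [[g bg]|nb] := pselect (exists g, common b g); [exists g|exists 1].
exists (z @` (B1 `*` B2)); split; first exact/finite_image/finite_setX.
move=> g [h1 [b1 [Hh1 Bb1 g1]]] [h2 [b2 [Hh2 Bb2 g2]]].
have gb : common (b1, b2) g by split; [rewrite g1|rewrite g2]; rewrite /= mulgK.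
have [z1 z2] := hz (b1, b2) (ex_intro _ g gb).
exists (g / z (b1, b2)), (z (b1, b2)); split; last by rewrite mulgVK.
  split; [have := subgroupF gb.1 z1|have := subgroupF gb.2 z2].
    by rewrite mulgKA.
  by rewrite mulgKA.
by exists (b1, b2).
Qed.

Theorem theorem1p2 (R : realType) (G : groupType) (PP : set (subgroup G))
    (countG : countable [set: G]) (hypG : relatively_hyperbolic PP) :
  (forall (H : subgroup G) (O : set (subgroup H)),
     relatively_quasiconvex R PP H ->
     induced_peripheral_structure PP O ->
     relatively_hyperbolic O) /\
  (forall H1 H2 : subgroup G,
     relatively_quasiconvex R PP H1 ->
     relatively_quasiconvex R PP H2 ->
     relatively_quasiconvex R PP (subgroupI H1 H2)).
Proof.
have finPP := hypG.1.
have [K [a [o pa]]] := relatively_hyperbolic_pointed hypG.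
split=> [H O qc|H1 H2 qc1 qc2].
  have [S [B [finS genS finB hullB]]] := quasiconvex_hull qc.
  exact: (hull_relatively_hyperbolic finPP pa finS genS finB hullB).
have [S1 [B1 [finS1 genS1 finB1 hullB1]]] := quasiconvex_hull qc1.
have [S [d [kappa [[finS genS [met proper linv]] near2]]]] := qc2.
have [B [finB hullB]] :=
  hull_of_other_generators finPP pa finS1 finS genS1 genS finB1 hullB1.
have [d0 _ _ _] := met.
have [D [finD interD]] := intersection_translates H1 H2 finB (proper 1 kappa).
have [n hn] : exists n : nat, forall z, D z -> (d z 1%g <= n%:R)%R.
  apply: (finite_bound finD) => [z _|z m n mn dm].
    by exists (Num.bound (d z 1)); apply/ltW/archi_boundP.
  by apply: le_trans dm _; rewrite ler_nat.
exists S, d, (n%:R)%R; split=> // x y c [H1x H2x] [H1y H2y] geo g gc.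
have [h [z [Hh Dz ->]]] : exists h z, [/\ (subgroupI H1 H2 : set G) h, D z & g = h * z].
  apply: interD; first by apply: hullB; exists x, y, c.
  have [h Hh gh] := near2 x y c H2x H2y geo g gc.
  exists h, (h^-1 * g); rewrite mulVKg; split=> //.
  exact: near_translate gh.
exists h => //; rewrite -[X in d _ X](mulg1 h) linv; exact: hn.
Qed.
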